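(* Let $n\ge 1$ be an integer and $h=1/(2n)$. Consider the Robin-Robin domain decomposition iteration described in the context, for the $P_1$ conforming finite element on the uniform criss grid of size $h$ on the unit square $\Omega=(0,1)^2$, decomposed along $\Gamma=\{x=1/2\}$. If the parameters are chosen as $\gamma_1=1$, $\gamma_2=64h^{-1}$ and $\theta=3/7$, then the error reduction factor is bounded by $1/7$, independently of the grid size $h$; that is, for all $m\ge 0$, $$\|e^{m+1}_{g_1}\|_{L^2(\Gamma)}\le \frac17\,\|e^{m}_{g_1}\|_{L^2(\Gamma)},\qquad e^m_{g_1}=g_1-g_1^m .$$
   Context: Mesh and spaces: $\Omega=(0,1)^2$ is divided into $2n\times 2n$ equal squares of side $h=1/(2n)$, each square being cut into two triangles by its diagonal from the lower-left to the upper-right corner. $V_h\subset H_0^1(\Omega)$ is the space of continuous piecewise linear functions on this triangulation vanishing on $\partial\Omega$. Let $\Omega_1=(0,1/2)\times(0,1)$, $\Omega_2=(1/2,1)\times(0,1)$, $\Gamma=\{1/2\}\times(0,1)$, $V_i=V_h|_{\Omega_i}$ ($i=1,2$) and $V_\Gamma=V_h|_\Gamma$. Put $$a_i(u,v)=\int_{\Omega_i}\nabla u\cdot\nabla v\,dx,\quad (f,v)_{\Omega_i}=\int_{\Omega_i}fv\,dx,\quad \langle u,v\rangle=\int_\Gamma uv\,ds .$$ Discrete solution: for given $f\in L^2(\Omega)$ let $u_h\in V_h$ be the finite element solution of $-\Delta u=f$ with zero Dirichlet data, i.e. $\int_\Omega\nabla u_h\cdot\nabla v\,dx=\int_\Omega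 fv\,dx$ for all $v\in V_h$; put $u=u_h|_{\Omega_1}$, $w=u_h|_{\Omega_2}$. For $\gamma_1,\gamma_2>0$, the exact interface data $g_1,g_2\in V_\Gamma$ are defined by $a_1(u,v)+\gamma_1\langle u,v\rangle=(f,v)_{\Omega_1}+\langle g_1,v\rangle$ for all $v\in V_1$, and $a_2(w,v)+\gamma_2\langle w,v\rangle=(f,v)_{\Omega_2}+\langle g_2,v\rangle$ for all $v\in V_2$. Robin-Robin domain decomposition iteration with parameters $\gamma_1,\gamma_2,\theta$: given $g_1^0\in V_\Gamma$ (e.g. $g_1^0=0$), for $m=0,1,2,\dots$: (1) find $u^m\in V_1$ with $a_1(u^m,v)+\gamma_1\langle u^m,v\rangle=(f,v)_{\Omega_1}+\langle g_1^m,v\rangle$ for all $v\in V_1$; (2) set $g_2^m=-g_1^m+(\gamma_2+\gamma_1)u^m$ on $\Gamma$; (3) find $w^m\in V_2$ with $a_2(w^m,v)+\gamma_2\langle w^m,v\rangle=(f,v)_{\Omega_2}+\langle g_2^m,v\rangle$ for all $v\in V_2$; (4) set $\tilde g_1^m=-g_2^m+(\gamma_1+\gamma_2)w^m$ on $\Gamma$; (5) set $g_1^{m+1}=\theta g_1^m+(1-\theta)\tilde g_1^m$. *)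

(* Defs.v *)
From HB Require Import structures.
From mathcomp Require Import all_boot all_order all_algebra.
From mathcomp Require Import all_classical all_reals all_analysis.

Set Implicit Arguments.
Unset Strict Implicit.
Unset Printing Implicit Defensive.

Import Order.TTheory GRing.Theory Num.Theory.
Import numFieldNormedType.Exports.

Local Open Scope classical_set_scope.
Local Open Scope ring_scope.

(* Functions on a subset D of the plane are represented by total functions
   R * R -> R; restriction to D is [f \_ D], the extension by zero of f
   restricted to D, so that functions on D equal as functions are equal in Rocq. *)

Section geometry.
Variable R : realType.

Definition mu2 := ((@lebesgue_measure R) \x (@lebesgue_measure R))%E.

Definition Omega : set (R * R) :=
  [set p | 0 < p.1 < 1 /\ 0 < p.2 < 1].
Definition Omega1 : set (R * R) :=
  [set p | 0 < p.1 < 1 / 2%:R /\ 0 < p.2 < 1].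
Definition Omega2 : set (R * R) :=
  [set p | 1 / 2%:R < p.1 < 1 /\ 0 < p.2 < 1].
Definition Gamma : set (R * R) :=
  [set p | p.1 = 1 / 2%:R /\ 0 < p.2 < 1].

End geometry.

Section mesh.
Variables (R : realType) (n : nat).

Definition h : R := 1 / (2 * n)%:R.

Definition square (i j : nat) : set (R * R) :=
  [set p | i%:R * h <= p.1 <= i.+1%:R * h /\ j%:R * h <= p.2 <= j.+1%:R * h].

(* The two closed triangles into which [square i j] is cut by its diagonal
   from the lower-left corner (i h, j h) to the upper-right corner. *)
Definition lower_triangle (i j : nat) : set (R * R) :=
  square i j `&` [set p | p.2 - j%:R * h <= p.1 - i%:R * h].
Definition upper_triangle (i j : nat) : set (R * R) :=
  square i j `&` [set p | p.1 - i%:R * h <= p.2 - j%:R * h].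

Definition mesh : set (set (R * R)) :=
  [set T | exists i j : nat, [/\ (i < 2 * n)%N, (j < 2 * n)%N &
     T = lower_triangle i j \/ T = upper_triangle i j]].

Definition affine_on (T : set (R * R)) (v : R * R -> R) : Prop :=
  exists a b c : R, forall p, T p -> v p = a * p.1 + b * p.2 + c.

(* A function vanishing on the boundary of Omega is identified with its
   extension by zero, which is continuous on the whole plane; the last condition
   encodes both the boundary condition and this convention. *)
Definition Vh : set (R * R -> R) :=
  [set v | [/\ continuous v,
               (forall T, mesh T -> affine_on T v) &
               (forall p, ~ Omega p -> v p = 0)]].

(* Restrictions are taken to closed subdomains, so that the elements of V1 and
   V2 carry their traces on Gamma. *)
Definition V1 : set (R * R -> R) :=
  [set v \_ (closure (@Omega1 R)) | v in Vh].
Definition V2 : set (R * R -> R) :=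
  [set v \_ (closure (@Omega2 R)) | v in Vh].
Definition VGamma : set (R * R -> R) :=
  [set v \_ (@Gamma R) | v in Vh].

End mesh.

Section forms.
Variable R : realType.
Implicit Types (D : set (R * R)) (u v f g : R * R -> R).

(* Classical partial derivatives.  For finite element functions they exist
   off the edges of the mesh, that is almost everywhere, and agree there with
   the weak ones. *)
Definition dx u (p : R * R) : R := derive1 (fun s : R => u (s, p.2)) p.1.
Definition dy u (p : R * R) : R := derive1 (fun t : R => u (p.1, t)) p.2.

Definition dirichlet D u v : R :=
  \int[@mu2 R]_(p in D) (dx u p * dx v p + dy u p * dy v p).

Definition inner D u v : R := \int[@mu2 R]_(p in D) (u p * v p).

Definition pairing u v : R :=
  \int[@lebesgue_measure R]_(t in `]0, 1[)
    (u (1 / 2%:R, t) * v (1 / 2%:R, t)).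

Definition normGamma u : R := Num.sqrt (pairing u u).

Definition L2Omega f : Prop :=
  (f \_ (@Omega R) : R * R -> R) \in Lfun (@mu2 R) 2%:E.

Definition fem_solution n f u : Prop :=
  Vh n u /\
  forall v, Vh n v -> dirichlet (@Omega R) u v = inner (@Omega R) f v.

Definition robin_identity D (V : set (R * R -> R)) (gamma : R) f g u : Prop :=
  forall v, V v ->
    dirichlet D u v + gamma * pairing u v = inner D f v + pairing g v.

Definition exact_interface_data n (gamma1 gamma2 : R) f uh g1 g2 : Prop :=
  let u := uh \_ (closure (@Omega1 R)) in
  let w := uh \_ (closure (@Omega2 R)) in
  [/\ VGamma n g1, VGamma n g2,
      robin_identity (@Omega1 R) (V1 n) gamma1 f g1 u &
      robin_identity (@Omega2 R) (V2 n) gamma2 f g2 w].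

(* [g1t] is the intermediate iterate written with a tilde in the algorithm. *)
Record robin_robin n (gamma1 gamma2 theta : R) f
    (u w g1 g2 g1t : nat -> R * R -> R) : Prop := RobinRobin {
  rr_init : VGamma n (g1 0%N) ;
  rr_u : forall m, V1 n (u m) /\
    robin_identity (@Omega1 R) (V1 n) gamma1 f (g1 m) (u m) ;
  rr_g2 : forall m p, Gamma p ->
    g2 m p = - g1 m p + (gamma2 + gamma1) * u m p ;
  rr_w : forall m, V2 n (w m) /\
    robin_identity (@Omega2 R) (V2 n) gamma2 f (g2 m) (w m) ;
  rr_g1t : forall m p, Gamma p ->
    g1t m p = - g2 m p + (gamma1 + gamma2) * w m p ;
  rr_g1 : forall m p, Gamma p ->
    g1 m.+1 p = theta * g1 m p + (1 - theta) * g1t m p }.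

End forms.

(* Main.v *)
Require Import Defs.
From mathcomp Require Import all_boot all_order all_algebra.
From mathcomp Require Import all_classical all_reals all_analysis.
From mathcomp Require Import measurable_realfun.
From mathcomp Require Import ring lra.

(** Let S be the discrete Dirichlet-to-Neumann operator of the interface: it
sends trace values to the flux of their discrete harmonic extension into one
half of the square, and is symmetric and positive for the L2(Gamma) inner
product.  On this mesh the Dirichlet form of piecewise linear functions is the
five-point form in their nodal values ([dirichlet_strip]), which is invariant
under the reflection of one half onto the other, although the mesh is not.  So
both halves have the same S, and the iteration multiplies the error by the
function 3/7 + 4/7 r(S) of S, where r(s) = (1 - s)(G - s) / ((s + 1)(s + G)) and
G = 64/h.  A factor 1/7 means -1 <= r <= -1/2 on the spectrum; the left
inequality holds for every s >= 0 and the right one reads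
3 s^2 - (1 + G) s + 3 G <= 0.  It holds as soon as the spectrum of S lies in
[s1, s2], where s1 = 3.05 + 0.35 h, s1 + s2 = (1 + G)/3 and s1 s2 >= G.

The upper bound comes from extending a trace by zero at the interior nodes
([energy_spike_le]), which gives S <= 9/h <= s2.  The lower bound ([energy_ge])
is a discrete form of the chain
|grad u|^2 >= u_x^2 + c u^2 >= 2 sqrt(c) u u_x, integrated over the left half,
where c = 48/(5 + 4 h^2) is a rational substitute for the constant pi^2 of the
Poincare inequality in the y direction ([wirtinger]).  The margin is small: the
quadratic inequality fails at s = 3, and the continuous argument with pi^2
would give the bound pi.

No diagonalization is needed, nor even the operator S.  If x and w are the
errors in the two halves (the second one reflected), the relations of the
iteration show that Z = (x + w)/(2G) and Z1 = (x - w)/2 are discrete harmonic,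
that S z = z1 for their traces z and z1, and that the old and the new
error e and e' of the interface datum are polynomials in S applied to z.  Then
|e|^2 - 49 |e'|^2 is 16 times the sum of Q(Z1) and G Q(Z), where Q(Z) is the
quadratic form of -3 S^2 + (1 + G) S - 3 G at z; it is nonnegative by
Cauchy-Schwarz for the form of S - s1 ([quadratic_ge0], [grid_contraction]).

The passage from integrals to nodal values needs three things.  Open triangles
fill each half up to a null set, on which the classical partial derivatives
are not controlled, so that the integrand is not known to be measurable there
([integral_off_null], [Rintegral_tiling]).  Every grid function vanishing on the
boundary is the nodal vector of a finite element function, a sum of Courant hat
functions ([interpolation]).  Finally the exact data satisfy
g1 + g2 = (gamma1 + gamma2) u on the interface, because the two Robin problems
add up to the problem on the whole square ([consistency]). *)

Import Order.TTheory GRing.Theory Num.Theory.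
Import numFieldNormedType.Exports.
Local Open Scope classical_set_scope.
Local Open Scope ring_scope.

Set Implicit Arguments.
Unset Strict Implicit.
Unset Printing Implicit Defensive.

(** * Energy and mass of grid functions *)

Section GridForms.
Variable R : realType.
Implicit Types (x y z : nat -> nat -> R) (u v w : nat -> R).

(** The contribution of a mesh square, cut along its diagonal, to the Dirichlet
integral: on the lower triangle the gradient is the horizontal increment along
the bottom edge and the vertical one along the right edge, on the upper triangle
those along the top and left edges.  The area h^2/2 of a triangle cancels the
factor h^-2 of the slopes. *)
Definition cell x y i j : R :=
  ((x i.+1 j - x i j) * (y i.+1 j - y i j)
   + (x i.+1 j.+1 - x i j.+1) * (y i.+1 j.+1 - y i j.+1)
   + (x i.+1 j.+1 - x i.+1 j) * (y i.+1 j.+1 - y i.+1 j)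
   + (x i j.+1 - x i j) * (y i j.+1 - y i j)) / 2%:R.

Definition energy (m N : nat) x y : R :=
  \sum_(0 <= i < m) \sum_(0 <= j < N) cell x y i j.

(** Six times the exact integral over the unit interval of the product of two
affine functions given by their end values. *)
Definition mass_elt u v j : R :=
  2%:R * (u j * v j) + u j * v j.+1 + u j.+1 * v j + 2%:R * (u j.+1 * v j.+1).

Definition mass (d : R) (N : nat) u v : R :=
  \sum_(0 <= j < N) d / 6%:R * mass_elt u v j.

Definition vanishing (N : nat) v := v 0%N = 0 /\ v N = 0.

Definition admissible (N : nat) x :=
  (forall j, x 0%N j = 0) /\ (forall i, vanishing N (x i)).

Lemma energyC m N x y : energy m N x y = energy m N y x.
Proof.
by apply: eq_bigr => i _; apply: eq_bigr => j _; rewrite /cell; ring.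
Qed.

Lemma energyDl m N a b x y z :
  energy m N (fun i j => a * x i j + b * y i j) z =
  a * energy m N x z + b * energy m N y z.
Proof.
rewrite /energy !mulr_sumr -big_split /=; apply: eq_bigr => i _.
rewrite !mulr_sumr -big_split /=; apply: eq_bigr => j _; rewrite /cell; ring.
Qed.

Lemma energyDr m N a b x y z :
  energy m N z (fun i j => a * x i j + b * y i j) =
  a * energy m N z x + b * energy m N z y.
Proof. by rewrite energyC energyDl !(energyC _ _ z). Qed.

Lemma massC d N u v : mass d N u v = mass d N v u.
Proof. by apply: eq_bigr => j _; rewrite /mass_elt; ring. Qed.

Lemma massDl d N a b u v w :
  mass d N (fun j => a * u j + b * v j) w =
  a * mass d N u w + b * mass d N v w.
Proof.
rewrite /mass !mulr_sumr -big_split /=; apply: eq_bigr => j _.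
by rewrite /mass_elt; ring.
Qed.

Lemma massDr d N a b u v w :
  mass d N w (fun j => a * u j + b * v j) =
  a * mass d N w u + b * mass d N w v.
Proof. by rewrite massC massDl !(massC _ _ w). Qed.

Lemma eq_mass d N u u' v v' : (forall j, (j <= N)%N -> u j = u' j) ->
  (forall j, (j <= N)%N -> v j = v' j) -> mass d N u v = mass d N u' v'.
Proof.
move=> uu' vv'; apply: eq_big_nat => j /andP[_ jN].
by rewrite /mass_elt !uu' ?vv' // ltnW.
Qed.

Lemma sum_shift N v : vanishing N v ->
  \sum_(0 <= j < N) v j.+1 = \sum_(0 <= j < N) v j.
Proof.
move=> [v0 vN]; apply/eqP; rewrite -subr_eq0 -sumrB telescope_sumr //.
by rewrite v0 vN subrr.
Qed.

Lemma vanishing_sqr N v : vanishing N v -> vanishing N (fun j => v j ^+ 2).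
Proof. by case=> v0 vN; rewrite /vanishing v0 vN expr0n. Qed.

(** This bound and [mass_ge] are the extreme eigenvalues of the element mass
matrix: the differences are multiples of the squares of v j - v j.+1 and of
v j + v j.+1. *)
Lemma mass_le d N v : 0 <= d -> vanishing N v ->
  mass d N v v <= d * \sum_(0 <= j < N) v j ^+ 2.
Proof.
move=> d0 hv; rewrite mulr_sumr.
have -> : \sum_(0 <= j < N) d * v j ^+ 2 =
  \sum_(0 <= j < N) d / 2%:R * (v j ^+ 2 + v j.+1 ^+ 2).
  rewrite -!mulr_sumr big_split /= (sum_shift (vanishing_sqr hv)).
  by field.
apply: ler_sum => j _; rewrite /mass_elt -subr_ge0.
have -> : d / 2%:R * (v j ^+ 2 + v j.+1 ^+ 2) - d / 6%:R *
  (2%:R * (v j * v j) + v j * v j.+1 + v j.+1 * v j + 2%:R * (v j.+1 * v j.+1))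
  = d / 6%:R * (v j - v j.+1) ^+ 2 by field.
by rewrite mulr_ge0 ?sqr_ge0 // divr_ge0.
Qed.

Lemma mass_ge d N v : 0 <= d -> vanishing N v ->
  d / 3%:R * \sum_(0 <= j < N) v j ^+ 2 <= mass d N v v.
Proof.
move=> d0 hv; rewrite mulr_sumr.
have -> : \sum_(0 <= j < N) d / 3%:R * v j ^+ 2 =
  \sum_(0 <= j < N) d / 6%:R * (v j ^+ 2 + v j.+1 ^+ 2).
  rewrite -!mulr_sumr big_split /= (sum_shift (vanishing_sqr hv)).
  by field.
apply: ler_sum => j _; rewrite /mass_elt -subr_ge0.
have -> : d / 6%:R *
  (2%:R * (v j * v j) + v j * v j.+1 + v j.+1 * v j + 2%:R * (v j.+1 * v j.+1))
  - d / 6%:R * (v j ^+ 2 + v j.+1 ^+ 2)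
  = d / 6%:R * (v j + v j.+1) ^+ 2 by field.
by rewrite mulr_ge0 ?sqr_ge0 // divr_ge0.
Qed.

Lemma mass_ge0 d N v : 0 <= d -> 0 <= mass d N v v.
Proof.
move=> d0; apply: sumr_ge0 => j _; rewrite mulr_ge0 ?divr_ge0 // /mass_elt.
by have := sqr_ge0 (v j + v j.+1); have := sqr_ge0 (v j);
   have := sqr_ge0 (v j.+1); lra.
Qed.

End GridForms.

(** * Spectral bounds and the contraction on the grid *)

Section Spectrum.
Variables (R : realType) (n : nat).
Hypothesis n_gt0 : (0 < n)%N.
Let N := (2 * n)%N.
Let d : R := h R n.
Implicit Types (x y : nat -> nat -> R) (u v : nat -> R).

Lemma h_gt0 : 0 < d.
Proof. by rewrite /d /h divr_gt0 // ltr0n muln_gt0. Qed.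

Lemma natN_h : N%:R * d = 1 :> R.
Proof. by rewrite /d /h mul1r mulfV // pnatr_eq0 -lt0n muln_gt0. Qed.

Lemma h_succ (i : nat) : i.+1%:R * d = i%:R * d + d.
Proof. by rewrite -natr1 mulrDl mul1r. Qed.

Lemma h_le_half : d <= 1 / 2%:R.
Proof.
have := natN_h; have := h_gt0 => dp.
have : (2%:R : R) <= N%:R by rewrite ler_nat leq_pmulr.
nra.
Qed.

(* A rational lower bound of the first eigenvalue 2 - 2 cos (pi h) of the discrete
   Laplacian on the interval; as h tends to 0 it behaves like 9.6 h^2. *)
Let lam : R := 48%:R * d ^+ 2 / (5%:R + 4%:R * d ^+ 2).

(* The supersolution is phi = p + al p^2 with p = t (1 - t), a polynomial
   substitute for sin (pi t).  The value of al makes the constant term of its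
   second difference vanish, so that this difference is a multiple of p. *)
Let al : R := (1 + d ^+ 2)^-1.
Let phi (t : R) := t * (1 - t) + al * (t * (1 - t)) ^+ 2.

Let al_gt0 : 0 < al.
Proof. by rewrite /al invr_gt0 ltr_wpDr ?sqr_ge0. Qed.

Lemma phi_supersolution t : 0 <= t <= 1 ->
  lam * phi t <= 2%:R * phi t - phi (t + d) - phi (t - d).
Proof.
move=> /andP[t0 t1]; set p := t * (1 - t).
have p0 : 0 <= p by rewrite mulr_ge0 ?subr_ge0.
have p4 : p <= 1 / 4%:R by have := sqr_ge0 (2%:R * t - 1); rewrite /p; nra.
have d1 : 0 < 1 + d ^+ 2 by rewrite ltr_wpDr ?sqr_ge0.
have d5 : 0 < 5%:R + 4%:R * d ^+ 2 by have := sqr_ge0 d; lra.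
have -> : 2%:R * phi t - phi (t + d) - phi (t - d) = 12%:R * al * d ^+ 2 * p.
  by rewrite /phi /p /al; field; rewrite gt_eqF.
have -> : lam * phi t = 12%:R * al * d ^+ 2 * p *
   (4%:R * (1 + d ^+ 2 + p) / (5%:R + 4%:R * d ^+ 2)).
  by rewrite /phi -/p /lam /al; field; rewrite !gt_eqF.
rewrite ler_piMr //.
  by rewrite mulr_ge0 // mulr_ge0 ?sqr_ge0 // mulr_ge0 // ltW.
by rewrite ler_pdivrMr // mul1r; lra.
Qed.

Lemma phi_gt0 t : 0 < t < 1 -> 0 < phi t.
Proof.
move=> /andP[t0 t1]; have p0 : 0 < t * (1 - t) by rewrite mulr_gt0 ?subr_gt0.
by rewrite /phi addr_gt0 // mulr_gt0 // exprn_gt0.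
Qed.

(** Discrete Picone identity: the positive supersolution phi bounds the lowest
eigenvalue from below.  Each term of the difference of the two sides is at least
the increment of T j = (phi_j - phi_{j-1}) v_j^2 / phi_j, and these increments
telescope to zero. *)
Lemma wirtinger v : vanishing N v ->
  lam * \sum_(0 <= j < N) v j ^+ 2 <= \sum_(0 <= j < N) (v j.+1 - v j) ^+ 2.
Proof.
move=> [v0 vN].
pose y j : R := j%:R * d.
pose T j := (phi (y j) - phi (y j - d)) / phi (y j) * v j ^+ 2.
suff step j : (j < N)%N ->
    T j.+1 - T j <= (v j.+1 - v j) ^+ 2 - lam * v j ^+ 2.
  have : \sum_(0 <= j < N) (T j.+1 - T j) <=
      \sum_(0 <= j < N) ((v j.+1 - v j) ^+ 2 - lam * v j ^+ 2).
    by rewrite !big_nat; apply: ler_sum => j /andP[_ /step].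
  rewrite telescope_sumr // sumrB -mulr_sumr /T v0 vN !expr0n /= !mulr0 subrr.
  by rewrite subr_ge0.
move=> jN; have d0 := h_gt0.
have yS : y j.+1 = y j + d by rewrite /y -natr1 mulrDl mul1r.
have ypos k : (0 < k < N)%N -> 0 < phi (y k).
  move=> /andP[k0 kN]; apply: phi_gt0; rewrite /y mulr_gt0 ?ltr0n //=.
  by rewrite -[ltRHS]natN_h ltr_pM2r // ltr_nat.
rewrite /T yS addrK -yS.
(* At both ends phi vanishes; there x / 0 = 0 agrees with v = 0. *)
case: (posnP j) => [j0|j0].
  subst j; rewrite v0 expr0n /= !mulr0 !subr0.
  have -> : y 0%N = 0 by rewrite /y mul0r.
  have -> : phi 0 = 0 by rewrite /phi mul0r expr0n /= mulr0 addr0.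
  rewrite subr0; have [S1N|] := ltnP 1 N; last first.
    by rewrite /N; case: n n_gt0 => // -[].
  by rewrite mulfV ?mul1r // gt_eqF // ypos.
have pj : 0 < phi (y j) by rewrite ypos // j0.
have yj01 : 0 <= y j <= 1.
  apply/andP; split; first by rewrite mulr_ge0 ?ler0n // ltW.
  by rewrite -[leRHS]natN_h ler_pM2r // ler_nat ltnW.
have sup := phi_supersolution yj01.
rewrite -yS in sup.
set a := phi (y j) in pj sup *; set b := phi (y j.+1) in sup *.
set c := phi (y j - d) in sup *.
have aN : a != 0 by rewrite gt_eqF.
have hT : lam * v j ^+ 2 <= (2%:R * a - b - c) / a * v j ^+ 2.
  by rewrite ler_wpM2r ?sqr_ge0 // ler_pdivlMr.
suff : (b - a) / b * v j.+1 ^+ 2 - (b - a) / a * v j ^+ 2 <= (v j.+1 - v j) ^+ 2.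
  move: hT.
  have -> : (2%:R * a - b - c) / a * v j ^+ 2 =
     (a - c) / a * v j ^+ 2 - (b - a) / a * v j ^+ 2 by field.
  lra.
have [SjN|] := ltnP j.+1 N; last first.
  move=> NSj; have -> : j.+1 = N by apply/eqP; rewrite eqn_leq jN NSj.
  have b0 : b = 0.
    rewrite /b; have -> : j.+1 = N by apply/eqP; rewrite eqn_leq jN NSj.
    by rewrite /y natN_h /phi subrr mulr0 expr0n /= mulr0 addr0.
  rewrite vN b0 !sub0r expr0n /= mulr0 sub0r sqrrN.
  by have -> : - (- a / a * v j ^+ 2) = v j ^+ 2 by field.
have pb : 0 < b by rewrite /b ypos.
have bN : b != 0 by rewrite gt_eqF.
rewrite -subr_ge0.
have -> : (v j.+1 - v j) ^+ 2 -
    ((b - a) / b * v j.+1 ^+ 2 - (b - a) / a * v j ^+ 2) =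
    (a * v j.+1 - b * v j) ^+ 2 / (a * b) by field; rewrite aN bN.
by rewrite divr_ge0 ?sqr_ge0 // mulr_ge0 // ltW.
Qed.

(** The lower bound s1 of the Dirichlet-to-Neumann operator.  Its linear growth
in h matters: the quadratic inequality asks for more than 3 + 24/G, that is for
more on coarse meshes. *)
Definition dtn_floor : R := 61%:R / 20%:R + 7%:R / 20%:R * d.

Lemma dtn_floor_gt0 : 0 < dtn_floor.
Proof. by have := h_gt0; rewrite /dtn_floor; lra. Qed.

(** The right side is the square of sinh mu, where 2 cosh mu = 2 + lam and mu is
the rate of decay, per column, of a discrete harmonic function oscillating
vertically with eigenvalue lam. *)
Lemma dtn_floor_rate : (d * dtn_floor) ^+ 2 <= lam + lam ^+ 2 / 4%:R.
Proof.
have d0 := h_gt0; have dh := h_le_half.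
set t := d ^+ 2.
have t0 : 0 <= t by rewrite sqr_ge0.
have t4 : t <= 1 / 4%:R by rewrite /t; nra.
have t5 : 0 < 5%:R + 4%:R * t by lra.
rewrite exprMn -/t.
have -> : lam + lam ^+ 2 / 4%:R =
    t * ((240%:R + 768%:R * t) / (5%:R + 4%:R * t) ^+ 2).
  by rewrite /lam -/t; field; rewrite gt_eqF.
apply: ler_wpM2l => //.
(* An intermediate bound, linear in t = h^2, that separates two polynomial
   inequalities valid for h <= 1/2. *)
apply: (@le_trans _ _ (48%:R / 5%:R + 9%:R * t)).
  by rewrite /dtn_floor /t; have := sqr_ge0 (d - 3%:R / 25%:R); nra.
rewrite ler_pdivlMr ?exprn_gt0 //.
rewrite -subr_ge0.
have -> : 240%:R + 768%:R * t - (48%:R / 5%:R + 9%:R * t) * (5%:R + 4%:R * t) ^+ 2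
  = t * (159%:R - 2568%:R / 5%:R * t - 144%:R * t ^+ 2) by field.
have tt : 0 <= t * (1 / 4%:R - t) by rewrite mulr_ge0 // subr_ge0.
apply: mulr_ge0; [exact: t0 | lra].
Qed.

(** One column of squares.  The vertical differences are bounded below by
[wirtinger], shared equally between the two sides of the column; then
(s - t)^2 + lam (s^2 + t^2)/2 >= r (s^2 - t^2) whenever
r^2 <= lam + lam^2/4, the discriminant condition. *)
Lemma row_energy x i : admissible N x ->
  d * dtn_floor * (\sum_(0 <= j < N) x i.+1 j ^+ 2 - \sum_(0 <= j < N) x i j ^+ 2) <=
  \sum_(0 <= j < N) cell x x i j.
Proof.
move=> [_ xb].
pose D j := (x i.+1 j - x i j) ^+ 2.
have Dv : vanishing N D.
  by rewrite /D /vanishing; have [-> ->] := xb i; have [-> ->] := xb i.+1;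
     rewrite subrr expr0n.
have -> : \sum_(0 <= j < N) cell x x i j = \sum_(0 <= j < N) D j +
    (\sum_(0 <= j < N) (x i.+1 j.+1 - x i.+1 j) ^+ 2 +
     \sum_(0 <= j < N) (x i j.+1 - x i j) ^+ 2) / 2%:R.
  transitivity ((\sum_(0 <= j < N) D j + \sum_(0 <= j < N) D j.+1) / 2%:R +
    (\sum_(0 <= j < N) (x i.+1 j.+1 - x i.+1 j) ^+ 2 +
     \sum_(0 <= j < N) (x i j.+1 - x i j) ^+ 2) / 2%:R).
    rewrite -mulrDl -!big_split /= mulr_suml; apply: eq_bigr => j _.
    by rewrite /cell /D; field.
  by rewrite (sum_shift Dv); field.
have := wirtinger (xb i); have := wirtinger (xb i.+1).
set P := \sum_(0 <= j < N) (x i.+1 j.+1 - _) ^+ 2.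
set Q := \sum_(0 <= j < N) (x i j.+1 - _) ^+ 2.
set a := \sum_(0 <= j < N) x i.+1 j ^+ 2; set b := \sum_(0 <= j < N) x i j ^+ 2.
move=> hP hQ.
suff : d * dtn_floor * (a - b) <= \sum_(0 <= j < N) D j + lam * (a + b) / 2%:R by lra.
rewrite /a /b -sumrB -big_split /= !mulr_sumr mulr_suml -big_split /=.
apply: ler_sum => j _; rewrite /D.
set s := x i.+1 j; set t := x i j.
have rr := dtn_floor_rate; set r := d * dtn_floor in rr *.
have r0 : 0 < r by rewrite mulr_gt0 ?h_gt0 ?dtn_floor_gt0.
have l0 : 0 <= lam.
  by rewrite /lam divr_ge0 ?mulr_ge0 ?sqr_ge0 // addr_ge0 ?mulr_ge0 ?sqr_ge0.
have k0 : 0 < 1 + lam / 2%:R + r by lra.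
rewrite -subr_ge0 -(pmulr_rge0 _ k0).
have -> : (1 + lam / 2%:R + r) *
  ((s - t) ^+ 2 + lam * (s ^+ 2 + t ^+ 2) / 2%:R - r * (s ^+ 2 - t ^+ 2)) =
  (s - (1 + lam / 2%:R + r) * t) ^+ 2 +
  (lam + lam ^+ 2 / 4%:R - r ^+ 2) * s ^+ 2 by field.
by rewrite addr_ge0 ?sqr_ge0 // mulr_ge0 ?sqr_ge0 // subr_ge0.
Qed.

(** The column bounds telescope from the boundary, where x vanishes, to the
interface. *)
Lemma energy_ge x : admissible N x ->
  dtn_floor * mass d N (x n) (x n) <= energy n N x x.
Proof.
move=> hx; have [x0 xb] := hx.
apply: (@le_trans _ _ (d * dtn_floor * \sum_(0 <= j < N) x n j ^+ 2)).
  rewrite [d * _]mulrC -mulrA ler_pM2l ?dtn_floor_gt0 //.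
  by apply: mass_le; [rewrite ltW ?h_gt0 | exact: xb].
pose S i := \sum_(0 <= j < N) x i j ^+ 2.
have S0 : S 0%N = 0 by rewrite /S big1 // => j _; rewrite x0 expr0n.
rewrite -/(S n) -[S n]subr0 -S0 -telescope_sumr // mulr_sumr.
by apply: ler_sum => i _; exact: row_energy.
Qed.

(** Extension of a trace by zero: not harmonic, but its energy is controlled by the
mass alone, which is what an upper bound of S needs. *)
Definition spike v : nat -> nat -> R := fun i j => if i == n then v j else 0.

Lemma spike_admissible v : vanishing N v -> admissible N (spike v).
Proof.
move=> hv; split=> [j|i]; rewrite /spike.
  by case: eqP => // n0; move: n_gt0; rewrite -n0.
by case: eqP => // _; split.
Qed.

Lemma spikeE v : spike v n = v.
Proof. by rewrite /spike eqxx. Qed.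

Lemma energy_spike_le v : vanishing N v ->
  energy n N (spike v) (spike v) <= 9%:R / d * mass d N v v.
Proof.
move=> hv; have d0 := h_gt0.
apply: (@le_trans _ _ (3%:R * \sum_(0 <= j < N) v j ^+ 2)); last first.
  have -> : 3%:R * \sum_(0 <= j < N) v j ^+ 2 =
     9%:R / d * (d / 3%:R * \sum_(0 <= j < N) v j ^+ 2).
    by field; rewrite gt_eqF.
  rewrite ler_wpM2l ?mass_ge // ?divr_ge0 //; exact: ltW.
have nS : n.-1.+1 = n by rewrite prednK.
rewrite /energy -nS big_nat_recr //= big_nat big1 ?add0r => [|i /andP[_ ilt]].
  have -> : 3%:R * \sum_(0 <= j < N) v j ^+ 2 =
     \sum_(0 <= j < N) 3%:R / 2%:R * (v j ^+ 2 + v j.+1 ^+ 2).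
    rewrite -mulr_sumr big_split /= (sum_shift (vanishing_sqr hv)).
    by field.
  apply: ler_sum => j _; rewrite /cell /spike nS eqxx.
  have /negPf -> : n.-1 != n by rewrite -{2}nS ltn_eqF.
  by have := sqr_ge0 (v j + v j.+1); lra.
apply: big1 => j _; rewrite /cell /spike.
have /negPf -> : i != n by rewrite ltn_eqF // -nS ltnS ltnW.
have /negPf -> : i.+1 != n by rewrite ltn_eqF // -nS ltnS.
by rewrite !subrr !mul0r !addr0 mul0r.
Qed.

Let G : R := 64%:R / d.

(** The form of -3 S^2 + (1 + G) S - 3 G at v, when u = S v. *)
Definition quadratic u v : R :=
  (1 + G) * mass d N u v - 3%:R * mass d N u u - 3%:R * G * mass d N v v.

(** Here u = S (z n).  With b = (S - s1) z, testing the positive form of S - s1 on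
c z - spike b gives |b|^2 <= c <b, z> for c = s2 - s1, that is
(S - s1)(s2 - S) >= 0 at z.  Since only an arbitrary extension of b is
tested, no harmonic extension has to be constructed. *)
Lemma quadratic_ge0 z u : admissible N z -> vanishing N u ->
  (forall y, admissible N y -> energy n N z y = mass d N u (y n)) ->
  0 <= quadratic u (z n).
Proof.
move=> hz hu hzu; have d0 := h_gt0; have dh := h_le_half.
pose s2 := (1 + G) / 3%:R - dtn_floor; pose c := s2 - dtn_floor.
have dG : d * G = 64%:R by rewrite /G; field; rewrite gt_eqF.
have G128 : 128%:R <= G by rewrite /G ler_pdivlMr //; lra.
have hs : G <= dtn_floor * s2.
  rewrite -(ler_pM2l d0) dG.
  have -> : d * (dtn_floor * s2) = dtn_floor * ((d + 64%:R) / 3%:R - dtn_floor * d).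
    by rewrite /s2; rewrite -dG; field.
  rewrite /dtn_floor; 
  have : 0 <= d * (1 / 2%:R - d) by rewrite mulr_ge0 ?subr_ge0 // ltW.
  nra.
have s29 : 9%:R / d <= s2.
  rewrite ler_pdivrMr // mulrC.
  have -> : d * s2 = (d + 64%:R) / 3%:R - dtn_floor * d by rewrite /s2 -dG; field.
  by rewrite /dtn_floor; nra.
have c0 : 0 < c.
  have : 18%:R <= 9%:R / d by rewrite ler_pdivlMr //; lra.
  by rewrite /c; rewrite /dtn_floor; lra.
pose b j := 1 * u j + - dtn_floor * z n j.
have hb : vanishing N b.
  by rewrite /b /vanishing; have [-> ->] := hu; have [-> ->] := hz.2 n;
     rewrite !mulr0 addr0.
have bE : b = fun j => 1 * u j + - dtn_floor * z n j by [].
clearbody b.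
pose y i j := c * z i j + -1 * spike b i j.
have hsp := spike_admissible hb.
have hy : admissible N y.
  rewrite /y; split=> [j|i]; first by rewrite hz.1 hsp.1 !mulr0 addr0.
  by rewrite /vanishing; have [-> ->] := hz.2 i; have [-> ->] := hsp.2 i;
     rewrite !mulr0 addr0.
have := energy_ge hy; have := energy_spike_le hb.
rewrite /y energyDl !energyDr [energy _ _ (spike b) z]energyC !hzu // spikeE.
rewrite massDl !massDr (massC _ _ b (z n)).
set E := energy _ _ _ _.
have E1 : mass d N u b = mass d N (z n) b * dtn_floor + mass d N b b.
  have -> : mass d N b b = mass d N (fun j => 1 * u j + - dtn_floor * z n j) b.
    by rewrite -bE.
  by rewrite massDl; ring.
have E2 : mass d N b b = mass d N u u - 2%:R * dtn_floor * mass d N u (z n)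
    + dtn_floor ^+ 2 * mass d N (z n) (z n).
  by rewrite bE massDl !massDr (massC _ _ (z n) u); ring.
have E3 : mass d N (z n) b = mass d N u (z n) - dtn_floor * mass d N (z n) (z n).
  by rewrite bE massDr (massC _ _ (z n) u); ring.
have B0 : 0 <= mass d N b b by apply: mass_ge0; exact: ltW.
have Z0 : 0 <= mass d N (z n) (z n) by apply: mass_ge0; exact: ltW.
move=> hE hy2.
have hE2 : E <= s2 * mass d N b b by apply: le_trans hE _; rewrite ler_wpM2r.
have key : 0 <= c * mass d N (z n) b - mass d N b b.
  rewrite -(pmulr_rge0 _ c0).
  move: hE2 hy2; rewrite E1.
  rewrite [mass d N u (z n)](_ : _ = mass d N (z n) b 
    + dtn_floor * mass d N (z n) (z n)); last by rewrite E3; ring.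
  have -> : s2 = c + dtn_floor by rewrite /c; ring.
  nra.
suff -> : quadratic u (z n) = 3%:R * (c * mass d N (z n) b - mass d N b b)
    + 3%:R * (dtn_floor * s2 - G) * mass d N (z n) (z n).
  by rewrite addr_ge0 ?mulr_ge0 // subr_ge0.
by rewrite /quadratic E2 E3 /c /s2; field.
Qed.

(** The identity |e|^2 - 49 |e'|^2 = 16 (Q(Z1) + G Q(Z)).  Besides the relations
of the iteration it uses the symmetry <S z1, z> = <z1, S z>, obtained by testing
each of the two harmonic functions on the other. *)
Lemma grid_contraction x w e e2 et e' :
  admissible N x -> admissible N w -> vanishing N e ->
  (forall y, admissible N y ->
     energy n N x y + mass d N (x n) (y n) = mass d N e (y n)) ->
  (forall j, e2 j = - e j + (G + 1) * x n j) ->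
  (forall y, admissible N y ->
     energy n N w y + G * mass d N (w n) (y n) = mass d N e2 (y n)) ->
  (forall j, et j = - e2 j + (1 + G) * w n j) ->
  (forall j, e' j = 3%:R / 7%:R * e j + (1 - 3%:R / 7%:R) * et j) ->
  49%:R * mass d N e' e' <= mass d N e e.
Proof.
move=> hx hw he hxe he2 hwe het he'; have d0 := h_gt0.
have G0 : 0 < G by rewrite /G divr_gt0.
have GN : G != 0 by rewrite gt_eqF.
pose k : R := (2%:R * G)^-1.
pose z i j := k * x i j + k * w i j.
pose z1 i j := 1 / 2%:R * x i j + - (1 / 2%:R) * w i j.
have hz : admissible N z.
  rewrite /z; split=> [j|i]; first by rewrite hx.1 hw.1 !mulr0 addr0.
  by rewrite /vanishing; have [-> ->] := hx.2 i; have [-> ->] := hw.2 i;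
     rewrite !mulr0 addr0.
have hz1 : admissible N z1.
  rewrite /z1; split=> [j|i]; first by rewrite hx.1 hw.1 !mulr0 addr0.
  by rewrite /vanishing; have [-> ->] := hx.2 i; have [-> ->] := hw.2 i;
     rewrite !mulr0 addr0.
pose p j := 1 * e j + -1 * x n j.
pose q j := 1 * e2 j + - G * w n j.
have hxp y : admissible N y -> energy n N x y = mass d N p (y n).
  by move=> /hxe; rewrite /p massDl => <-; ring.
have hwq y : admissible N y -> energy n N w y = mass d N q (y n).
  by move=> /hwe; rewrite /q massDl => <-; ring.
pose z2 j := 1 / 2%:R * p j + - (1 / 2%:R) * q j.
have hz2 : vanishing N z2.
  rewrite /z2 /p /q /vanishing !he2; have [-> ->] := hx.2 n.
  by have [-> ->] := hw.2 n; have [-> ->] := he; split; ring.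
have pqE : (fun j => k * p j + k * q j) = z1 n.
  apply/funext => j; rewrite /z1 /p /q he2 /k; field; exact: GN.
have Az y : admissible N y -> energy n N z y = mass d N (z1 n) (y n).
  by move=> hy; rewrite -pqE massDl energyDl hxp // hwq.
have Az1 y : admissible N y -> energy n N z1 y = mass d N z2 (y n).
  by move=> hy; rewrite /z2 massDl energyDl hxp // hwq.
have Q0 := quadratic_ge0 hz (hz1.2 n) Az.
have Q1 := quadratic_ge0 hz1 hz2 Az1.
have sym : mass d N z2 (z n) = mass d N (z1 n) (z1 n).
  by rewrite -Az1 // -Az // energyC.
have eE : e = fun j => 1 * (fun j => 1 * z2 j + (1 + G) * z1 n j) j + G * z n j.
  apply/funext => j; rewrite /z2 /z1 /z /p /q he2 /k; field; exact: GN.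
have e'E : e' = fun j => 1 / 7%:R * (fun j => 7%:R * z2 j + - (1 + G) * z1 n j) j
    + G * z n j.
  apply/funext => j; rewrite he' het /z2 /z1 /z /p /q he2 /k; field; exact: GN.
rewrite -subr_ge0.
suff -> : mass d N e e - 49%:R * mass d N e' e' =
   16%:R * (quadratic z2 (z1 n) + G * quadratic (z1 n) (z n)).
  by rewrite mulr_ge0 // addr_ge0 // mulr_ge0 // ltW.
clear -sym eE e'E; clearbody z z1 z2.
rewrite eE e'E !(massDl, massDr) /quadratic (massC _ _ (z1 n) z2).
by rewrite !(massC _ _ (z n)) sym; field.
Qed.

End Spectrum.

(** * Nodal values and Courant hat functions *)

Section Hats.
Variables (R : realType) (n : nat).
Hypothesis n_gt0 : (0 < n)%N.
Local Notation N := (2 * n)%N.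
Local Notation d := (h R n).

Lemma continuous_max (T : topologicalType) (f g : T -> R) :
  continuous f -> continuous g -> continuous (fun x => Num.max (f x) (g x)).
Proof.
move=> cf cg x.
rewrite (_ : (fun x => _) = fun x => (f x + g x + `|f x - g x|) / 2%:R); last first.
  by apply/funext => y; rewrite maxr_absE.
apply: cvgM; last exact: cvg_cst.
apply: cvgD; first by apply: cvgD; [exact: cf | exact: cg].
by apply: cvg_norm; apply: cvgB; [exact: cf | exact: cg].
Qed.

(** In coordinates scaled by the mesh size and centered at the node, the six
triangles around it form the hexagon max (|X|, |Y|, |X - Y|) <= 1, and the
function is one minus this norm; the term |X - Y| reflects the direction of the
diagonals. *)
Definition hat (a b : nat) (p : R * R) : R :=
  Num.max 0 (1 - Num.max (Num.max `|p.1 * N%:R - a%:R| `|p.2 * N%:R - b%:R|)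
                 `|p.1 * N%:R - a%:R - (p.2 * N%:R - b%:R)|).

Lemma hat_continuous a b : continuous (hat a b).
Proof.
have c1 : continuous (fun p : R * R => p.1 * N%:R - a%:R).
  move=> p; apply: cvgB; last exact: cvg_cst.
  by apply: cvgM; [exact: cvg_fst | exact: cvg_cst].
have c2 : continuous (fun p : R * R => p.2 * N%:R - b%:R).
  move=> p; apply: cvgB; last exact: cvg_cst.
  by apply: cvgM; [exact: cvg_snd | exact: cvg_cst].
apply: continuous_max; first by move=> p; exact: cvg_cst.
move=> p; apply: cvgB; first exact: cvg_cst.
move: p; apply: continuous_max.
  by apply: continuous_max => p; apply: cvg_norm; [exact: c1 | exact: c2].
by move=> p; apply: cvg_norm; apply: cvgB; [exact: c1 | exact: c2].
Qed.

Lemma hat_zero a b p :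
  1 <= `|p.1 * N%:R - a%:R| \/ 1 <= `|p.2 * N%:R - b%:R| \/
  1 <= `|p.1 * N%:R - a%:R - (p.2 * N%:R - b%:R)| -> hat a b p = 0.
Proof.
move=> H; rewrite /hat; apply/max_idPl; rewrite subr_le0 !le_max.
by case: H => [->|[->|->]]; rewrite ?orbT.
Qed.

Lemma hat_val a b p (X Y c : R) :
  X = p.1 * N%:R - a%:R -> Y = p.2 * N%:R - b%:R -> 0 <= c ->
  `|X| <= 1 - c -> `|Y| <= 1 - c -> `|X - Y| <= 1 - c ->
  [\/ `|X| = 1 - c, `|Y| = 1 - c | `|X - Y| = 1 - c] -> hat a b p = c.
Proof.
move=> EX EY c0 hX hY hXY hc; rewrite /hat -EX -EY.
have -> : Num.max (Num.max `|X| `|Y|) `|X - Y| = 1 - c.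
  apply/le_anti; rewrite !ge_max hX hY hXY /= !le_max.
  by case: hc => ->; rewrite lexx ?orbT.
by rewrite opprB addrC subrK; apply/max_idPr.
Qed.

Lemma h_natN : d * N%:R = 1.
Proof. by rewrite mulrC natN_h. Qed.

(* The hat function of index a is not identically zero on [i, i + 1] only if a is
   one of the two ends. *)
Let near_or_far (i a : nat) :
  [\/ i.+1 = a, i = a
    | forall x : R, i%:R <= x <= i.+1%:R -> 1 <= `|x - a%:R| ].
Proof.
case: (ltngtP i a) => [ia|ai|->]; last by apply: Or32.
  move: ia; rewrite leq_eqVlt => /predU1P[->|ia1]; first by apply: Or31.
  apply: Or33 => x /andP[x1 x2].
  have : i.+2%:R <= a%:R :> R by rewrite ler_nat.
  by rewrite -natr1 => h2; rewrite ler0_norm; lra.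
apply: Or33 => x /andP[x1 x2].
have : a.+1%:R <= i%:R :> R by rewrite ler_nat.
by rewrite -natr1 => h2; rewrite ger0_norm; lra.
Qed.

Lemma squareP i j (p : R * R) : square n i j p ->
  (i%:R <= p.1 * N%:R <= i.+1%:R) /\ (j%:R <= p.2 * N%:R <= j.+1%:R).
Proof.
move=> [/andP[a b] /andP[c e]].
have Np : 0 < N%:R :> R by rewrite ltr0n muln_gt0.
have E (k : nat) : k%:R = k%:R * d * N%:R :> R by rewrite -mulrA h_natN mulr1.
by rewrite (E i) (E i.+1) (E j) (E j.+1) !ler_pM2r // a b c e.
Qed.

(** On each triangle of the support the maximum defining the hat function is
attained throughout by the same term with the same sign.  Among the four squares around the node,
two contribute one triangle and the other two contribute both. *)
Lemma hat_affine a b (T : set (R * R)) : mesh n T -> affine_on T (hat a b).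
Proof.
have zero : (forall p, T p -> hat a b p = 0) -> affine_on T (hat a b).
  by move=> H; exists 0, 0, 0 => p /H ->; rewrite !mul0r !addr0.
have lin (x y z : R) : (forall p, T p ->
    hat a b p = x * (p.1 * N%:R) + y * (p.2 * N%:R) + z) -> affine_on T (hat a b).
  by move=> H; exists (x * N%:R), (y * N%:R), z => p /H ->; ring.
have E (k : nat) : k%:R = k%:R * d * N%:R :> R by rewrite -mulrA h_natN mulr1.
have Np : 0 < N%:R :> R by rewrite ltr0n muln_gt0.
move=> [i [j [_ _ TE]]].
have sq p : T p -> (i%:R <= p.1 * N%:R <= i%:R + 1) /\
    (j%:R <= p.2 * N%:R <= j%:R + 1).
  by rewrite !natr1; case: TE => -> [] /squareP.
have dg : (forall p, T p -> p.2 * N%:R - j%:R <= p.1 * N%:R - i%:R) \/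
    (forall p, T p -> p.1 * N%:R - i%:R <= p.2 * N%:R - j%:R).
  by case: TE => ->; [left|right] => p [_ /= hp];
    have := ler_wpM2r (ltW Np) hp; rewrite !mulrBl -!E.
have [far|[k ka kb]] : (forall x : R, i%:R <= x <= i.+1%:R -> 1 <= `|x - a%:R|) \/
    exists2 k : R, a%:R = i%:R + k & k = 1 \/ k = 0.
  case: (near_or_far i a) => [<-|<-|far]; [right|right|by left].
  - by exists 1; [rewrite natr1 | left].
  - by exists 0; [rewrite addr0 | right].
  by apply: zero => p /sq; rewrite natr1 => -[hx _]; apply: hat_zero; left;
    exact: far.
have [far|[l lb lb']] : (forall x : R, j%:R <= x <= j.+1%:R -> 1 <= `|x - b%:R|) \/
    exists2 k : R, b%:R = j%:R + k & k = 1 \/ k = 0.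
  case: (near_or_far j b) => [<-|<-|far]; [right|right|by left].
  - by exists 1; [rewrite natr1 | left].
  - by exists 0; [rewrite addr0 | right].
  by apply: zero => p /sq; rewrite !natr1 => -[_ hy]; apply: hat_zero; right; left;
    exact: far.
have {}sq p : T p -> [/\ i%:R <= p.1 * N%:R, p.1 * N%:R <= i%:R + 1,
    j%:R <= p.2 * N%:R & p.2 * N%:R <= j%:R + 1].
  by move=> /sq[/andP[? ?] /andP[? ?]].
case: dg => dg.
- have {}dg p : T p -> _ := fun Tp => conj (sq p Tp) (dg p Tp).
  case: kb => kE; case: lb' => lE; rewrite {}kE in ka; rewrite {}lE in lb.
  + apply: (lin 0 1 (1 - b%:R)) => p /dg[[x1 x2 y1 y2] xy].
    apply: (@hat_val _ _ _ _ _ _ erefl erefl);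
      rewrite ?ler_norml ?ka ?lb; try lra.
    by apply: Or32; rewrite ler0_norm; lra.
  + apply: (lin 1 (-1) (1 - a%:R + b%:R)) => p /dg[[x1 x2 y1 y2] xy].
    apply: (@hat_val _ _ _ _ _ _ erefl erefl);
      rewrite ?ler_norml ?ka ?lb; try lra.
    by apply: Or33; rewrite ler0_norm; lra.
  + apply: zero => p /dg[[x1 x2 y1 y2] xy]; apply: hat_zero; right; right.
    by rewrite ka lb ger0_norm; lra.
  + apply: (lin (-1) 0 (1 + a%:R)) => p /dg[[x1 x2 y1 y2] xy].
    apply: (@hat_val _ _ _ _ _ _ erefl erefl);
      rewrite ?ler_norml ?ka ?lb; try lra.
    by apply: Or31; rewrite ger0_norm; lra.
- have {}dg p : T p -> _ := fun Tp => conj (sq p Tp) (dg p Tp).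
  case: kb => kE; case: lb' => lE; rewrite {}kE in ka; rewrite {}lE in lb.
  + apply: (lin 1 0 (1 - a%:R)) => p /dg[[x1 x2 y1 y2] xy].
    apply: (@hat_val _ _ _ _ _ _ erefl erefl);
      rewrite ?ler_norml ?ka ?lb; try lra.
    by apply: Or31; rewrite ler0_norm; lra.
  + apply: zero => p /dg[[x1 x2 y1 y2] xy]; apply: hat_zero; right; right.
    by rewrite ka lb ler0_norm; lra.
  + apply: (lin (-1) 1 (1 + a%:R - b%:R)) => p /dg[[x1 x2 y1 y2] xy].
    apply: (@hat_val _ _ _ _ _ _ erefl erefl);
      rewrite ?ler_norml ?ka ?lb; try lra.
    by apply: Or33; rewrite ger0_norm; lra.
  + apply: (lin 0 (-1) (1 + b%:R)) => p /dg[[x1 x2 y1 y2] xy].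
    apply: (@hat_val _ _ _ _ _ _ erefl erefl);
      rewrite ?ler_norml ?ka ?lb; try lra.
    by apply: Or32; rewrite ger0_norm; lra.
Qed.

Lemma hat_boundary a b p : (0 < a < N)%N -> (0 < b < N)%N ->
  ~ Omega p -> hat a b p = 0.
Proof.
have Np : 0 < N%:R :> R by rewrite ltr0n muln_gt0.
have side (k : nat) (x : R) : (0 < k < N)%N -> ~ (0 < x < 1) ->
    1 <= `|x * N%:R - k%:R|.
  move=> /andP[k0 kN] /negP; rewrite negb_and -!leNgt.
  have k1 : 1 <= k%:R :> R by rewrite ler1n.
  have kN1 : k%:R + 1 <= N%:R :> R by rewrite natr1 ler_nat.
  by case/orP => hx; [rewrite ler0_norm | rewrite ger0_norm]; nra.
move=> ha hb hp; apply: hat_zero.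
have [x01|/negP x01] := boolP (0 < p.1 < 1); last by left; exact: side.
right; left; apply: side => // y01; apply: hp; split => //.
Qed.

Lemma hat_node a b i j : hat a b (i%:R * d, j%:R * d) = ((i == a) && (j == b))%:R.
Proof.
have E (k : nat) : k%:R * d * N%:R = k%:R :> R by rewrite -mulrA h_natN mulr1.
have far (k l : nat) : k != l -> 1 <= `|k%:R - l%:R| :> R.
  rewrite neq_ltn => /orP[]; rewrite -(ler_nat R) -natr1 => h1.
    by rewrite ler0_norm; lra.
  by rewrite ger0_norm; lra.
case: eqP => [->|/eqP ia]; last first.
  by apply: hat_zero; rewrite !E; left; exact: far.
case: eqP => [->|/eqP jb]; last first.
  by apply: hat_zero; rewrite !E; right; left; exact: far.
by apply: (@hat_val _ _ _ 0 0); rewrite ?E ?subrr ?normr0 //; apply: Or31.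
Qed.

Lemma Vh_lin (s t : R) (v w : R * R -> R) :
  Vh n v -> Vh n w -> Vh n (fun p => s * v p + t * w p).
Proof.
move=> [cv av zv] [cw aw zw]; split.
- move=> p; apply: cvgD; apply: cvgM; try exact: cvg_cst; [exact: cv|exact: cw].
- move=> T hT; have [a1 [b1 [c1 h1]]] := av _ hT.
  have [a2 [b2 [c2 h2]]] := aw _ hT.
  exists (s * a1 + t * a2), (s * b1 + t * b2), (s * c1 + t * c2) => p Tp.
  by rewrite h1 // h2 //; ring.
- by move=> p hp; rewrite zv // zw // !mulr0 addr0.
Qed.

Lemma Vh_zero : Vh n (fun _ : R * R => 0 : R).
Proof.
split=> [p|T _|//]; first exact: cvg_cst.
by exists 0, 0, 0 => p _; rewrite !mul0r !addr0.
Qed.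

(** Finite element functions whose product with an L2 function can be integrated. *)
Definition tame (v : R * R -> R) : Prop :=
  [/\ Vh n v, measurable_fun setT v & exists M : R, forall p, `|v p| <= M].

Lemma tame_lin (s t : R) (v w : R * R -> R) :
  tame v -> tame w -> tame (fun p => s * v p + t * w p).
Proof.
move=> [hv mv [A hA]] [hw mw [B hB]]; split; first exact: Vh_lin.
  by apply: measurable_funD; apply: measurable_funM.
exists (`|s| * A + `|t| * B) => p; apply: (le_trans (ler_normD _ _)).
by rewrite !normrM lerD // ler_wpM2l.
Qed.

Lemma tame_zero : tame (fun=> 0).
Proof.
by split; [exact: Vh_zero | exact: measurable_cst | exists 0 => p; rewrite normr0].
Qed.

Lemma tame_sum (I : eqType) (r : seq I) (F : I -> R * R -> R) :
  (forall i, i \in r -> tame (F i)) -> tame (fun p => \sum_(i <- r) F i p).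
Proof.
elim: r => [|i r IH] hF.
  rewrite (_ : (fun p => _) = fun=> 0); first exact: tame_zero.
  by apply/funext => p; rewrite big_nil.
rewrite (_ : (fun p => _) = fun p => 1 * F i p + 1 * \sum_(i <- r) F i p).
  apply: tame_lin; first by apply: hF; rewrite mem_head.
  by apply: IH => k kr; apply: hF; rewrite inE kr orbT.
by apply/funext => p; rewrite big_cons !mul1r.
Qed.

Lemma hat_tame a b : (0 < a < N)%N -> (0 < b < N)%N -> tame (hat a b).
Proof.
move=> ha hb; split.
- split; [exact: hat_continuous | exact: hat_affine |].
  by move=> p; exact: hat_boundary.
- have m1 : measurable_fun setT (fun p : R * R => p.1 * N%:R - a%:R).
    by apply: measurable_funB => //; apply: measurable_funM.
  have m2 : measurable_fun setT (fun p : R * R => p.2 * N%:R - b%:R).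
    by apply: measurable_funB => //; apply: measurable_funM.
  apply: measurable_maxr => //; apply: measurable_funB => //.
  apply: measurable_maxr; first apply: measurable_maxr.
  + exact: measurableT_comp.
  + exact: measurableT_comp.
  + by apply: measurableT_comp => //; exact: measurable_funB.
- exists 1 => p; have h0 : 0 <= hat a b p by rewrite /hat le_max lexx.
  by rewrite ger0_norm // /hat ge_max ler01 /= gerBl !le_max normr_ge0.
Qed.

Lemma sum_delta (F : nat -> R) i :
  \sum_(1 <= a < N) F a * (i == a)%:R = if (0 < i < N)%N then F i else 0.
Proof.
case: ifPn => hi.
  rewrite (bigD1_seq i) ?mem_index_iota ?iota_uniq //= eqxx mulr1 big1 ?addr0 //.
  by move=> a ai; rewrite eq_sym (negPf ai) mulr0.
rewrite big_nat big1 // => a ha; case: eqP => [ia|]; last by rewrite mulr0.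
by move: hi; rewrite ia ha.
Qed.

(** Only interior nodes carry hat functions, which imposes the boundary condition. *)
Lemma interpolation (c : nat -> nat -> R) : exists2 v, tame v &
  forall i j, v (i%:R * d, j%:R * d) =
    if (0 < i < N)%N && (0 < j < N)%N then c i j else 0.
Proof.
exists (fun p => \sum_(1 <= a < N) \sum_(1 <= b < N) c a b * hat a b p).
  apply: tame_sum => a; rewrite mem_index_iota => ha.
  apply: tame_sum => b; rewrite mem_index_iota => hb.
  rewrite (_ : (fun p => _) = fun p => c a b * hat a b p + 0 * hat a b p).
    by apply: tame_lin; exact: hat_tame.
  by apply/funext => p; rewrite mul0r addr0.
move=> i j.
transitivity (\sum_(1 <= a < N) (\sum_(1 <= b < N) c a b * (j == b)%:R) * (i == a)%:R).
  apply: eq_bigr => a _; rewrite mulr_suml; apply: eq_bigr => b _.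
  by rewrite hat_node -mulnb natrM; ring.
rewrite (sum_delta (fun a => \sum_(1 <= b < N) c a b * (j == b)%:R)).
by case: ifP => //= _; exact: (sum_delta (c i)).
Qed.

Definition node (v : R * R -> R) i j : R := v (i%:R * d, j%:R * d).

Definition open_lower i j : set (R * R) :=
  [set p | [/\ j%:R * d < p.2, p.2 - j%:R * d < p.1 - i%:R * d & p.1 < i.+1%:R * d]].
Definition open_upper i j : set (R * R) :=
  [set p | [/\ i%:R * d < p.1, p.1 - i%:R * d < p.2 - j%:R * d & p.2 < j.+1%:R * d]].

Let d_gt0 : 0 < d := h_gt0 R n_gt0.

Lemma lower_affine v i j p : Vh n v -> (i < N)%N -> (j < N)%N ->
  lower_triangle n i j p ->
  v p = node v i j + (node v i.+1 j - node v i j) / d * (p.1 - i%:R * d)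
        + (node v i.+1 j.+1 - node v i.+1 j) / d * (p.2 - j%:R * d).
Proof.
move=> [_ av _] iN jN hp.
have [|a [b [c E]]] := av (lower_triangle n i j).
  by exists i, j; split => //; left.
have dN : d != 0 by rewrite gt_eqF.
have L k l : (k == i /\ l == j) \/ (k == i.+1 /\ l == j) \/ (k == i.+1 /\ l == j.+1) ->
    node v k l = a * (k%:R * d) + b * (l%:R * d) + c.
  move=> H; rewrite /node E //; move: (d_gt0) => d0.
  by case: H => [[/eqP -> /eqP ->]|[[/eqP -> /eqP ->]|[/eqP -> /eqP ->]]];
    rewrite /lower_triangle /square /= !h_succ; split=> /=; [split; apply/andP; split|..]; lra.
rewrite (L i j) ?eqxx; last by left.
rewrite (L i.+1 j) ?eqxx; last by right; left.
rewrite (L i.+1 j.+1) ?eqxx; last by right; right.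
by rewrite (E p hp) !h_succ; field.
Qed.

Lemma upper_affine v i j p : Vh n v -> (i < N)%N -> (j < N)%N ->
  upper_triangle n i j p ->
  v p = node v i j + (node v i.+1 j.+1 - node v i j.+1) / d * (p.1 - i%:R * d)
        + (node v i j.+1 - node v i j) / d * (p.2 - j%:R * d).
Proof.
move=> [_ av _] iN jN hp.
have [|a [b [c E]]] := av (upper_triangle n i j).
  by exists i, j; split => //; right.
have dN : d != 0 by rewrite gt_eqF.
have L k l : (k == i /\ l == j) \/ (k == i /\ l == j.+1) \/ (k == i.+1 /\ l == j.+1) ->
    node v k l = a * (k%:R * d) + b * (l%:R * d) + c.
  move=> H; rewrite /node E //; move: (d_gt0) => d0.
  by case: H => [[/eqP -> /eqP ->]|[[/eqP -> /eqP ->]|[/eqP -> /eqP ->]]];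
    rewrite /upper_triangle /square /= !h_succ; split=> /=; [split; apply/andP; split|..]; lra.
rewrite (L i j) ?eqxx; last by left.
rewrite (L i j.+1) ?eqxx; last by right; left.
rewrite (L i.+1 j.+1) ?eqxx; last by right; right.
by rewrite (E p hp) !h_succ; field.
Qed.

(** Only an interval around the point matters, so that this applies to functions
cut off outside a subdomain. *)
Lemma derive1_affine (f : R -> R) (l r a c x : R) : l < x < r ->
  (forall s, l < s < r -> f s = a * s + c) -> derive1 f x = a.
Proof.
move=> lxr hf; rewrite derive1E.
have -> : 'D_1 f x = 'D_1 (fun s => a * s + c) x.
  apply: near_eq_derive; near=> s; apply: hf.
  near: s.
  have : x \in `]l, r[ by rewrite in_itv.
  by move=> /near_in_itvoo; apply: filterS => s; rewrite in_itv.
suff H : is_derive x (1 : R) (fun s : R => a * s + c) a by rewrite derive_val.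
apply: is_derive_eq; rewrite !(scaler0, addr0, add0r); first exact: mulr1.
Unshelve. all: by end_near. Qed.

Lemma open_lower_sub i j : open_lower i j `<=` lower_triangle n i j.
Proof.
move=> p [h1 h2 h3]; move: h3; rewrite h_succ => h3.
by rewrite /lower_triangle /square /= !h_succ; split; [split; apply/andP; split|]; lra.
Qed.

Lemma open_upper_sub i j : open_upper i j `<=` upper_triangle n i j.
Proof.
move=> p [h1 h2 h3]; move: h3; rewrite h_succ => h3.
by rewrite /upper_triangle /square /= !h_succ; split; [split; apply/andP; split|]; lra.
Qed.

Lemma grad_open_lower v (D : set (R * R)) i j p : Vh n v -> (i < N)%N -> (j < N)%N ->
  open_lower i j `<=` D -> open_lower i j p ->
  dx (v \_ D) p = (node v i.+1 j - node v i j) / d /\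
  dy (v \_ D) p = (node v i.+1 j.+1 - node v i.+1 j) / d.
Proof.
move=> hv iN jN sD hp; have [h1 h2 h3] := hp.
have E q : open_lower i j q -> (v \_ D) q = node v i j
    + (node v i.+1 j - node v i j) / d * (q.1 - i%:R * d)
    + (node v i.+1 j.+1 - node v i.+1 j) / d * (q.2 - j%:R * d).
  by move=> hq; rewrite patchE (mem_set (sD _ hq)) (lower_affine hv iN jN (open_lower_sub hq)).
split.
- apply: (@derive1_affine _ (i%:R * d + (p.2 - j%:R * d)) (i.+1%:R * d) _
   (node v i j - (node v i.+1 j - node v i j) / d * (i%:R * d) +
    (node v i.+1 j.+1 - node v i.+1 j) / d * (p.2 - j%:R * d))).
    by apply/andP; split; lra.
  move=> s /andP[s1 s2]; rewrite E /=; first by ring.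
  by split => //=; lra.
- apply: (@derive1_affine _ (j%:R * d) (j%:R * d + (p.1 - i%:R * d)) _
   (node v i j - (node v i.+1 j.+1 - node v i.+1 j) / d * (j%:R * d) +
    (node v i.+1 j - node v i j) / d * (p.1 - i%:R * d))).
    by apply/andP; split; lra.
  move=> s /andP[s1 s2]; rewrite E /=; first by ring.
  by split => //=; lra.
Qed.

Lemma grad_open_upper v (D : set (R * R)) i j p : Vh n v -> (i < N)%N -> (j < N)%N ->
  open_upper i j `<=` D -> open_upper i j p ->
  dx (v \_ D) p = (node v i.+1 j.+1 - node v i j.+1) / d /\
  dy (v \_ D) p = (node v i j.+1 - node v i j) / d.
Proof.
move=> hv iN jN sD hp; have [h1 h2 h3] := hp.
have E q : open_upper i j q -> (v \_ D) q = node v i j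
    + (node v i.+1 j.+1 - node v i j.+1) / d * (q.1 - i%:R * d)
    + (node v i j.+1 - node v i j) / d * (q.2 - j%:R * d).
  by move=> hq; rewrite patchE (mem_set (sD _ hq)) (upper_affine hv iN jN (open_upper_sub hq)).
split.
- apply: (@derive1_affine _ (i%:R * d) (i%:R * d + (p.2 - j%:R * d)) _
   (node v i j - (node v i.+1 j.+1 - node v i j.+1) / d * (i%:R * d) +
    (node v i j.+1 - node v i j) / d * (p.2 - j%:R * d))).
    by apply/andP; split; lra.
  move=> s /andP[s1 s2]; rewrite E /=; first by ring.
  by split => //=; lra.
- apply: (@derive1_affine _ (j%:R * d + (p.1 - i%:R * d)) (j.+1%:R * d) _
   (node v i j - (node v i j.+1 - node v i j) / d * (j%:R * d) +
    (node v i.+1 j.+1 - node v i j.+1) / d * (p.1 - i%:R * d))).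
    by apply/andP; split; lra.
  move=> s /andP[s1 s2]; rewrite E /=; first by ring.
  by split => //=; lra.
Qed.

Lemma node_boundary v i j : Vh n v ->
  ~~ ((0 < i < N) && (0 < j < N))%N -> node v i j = 0.
Proof.
move=> [_ _ zv] hij; apply: zv => -[/=].
have H (k : nat) : 0 < k%:R * d < 1 -> (0 < k < N)%N.
  by rewrite pmulr_lgt0 // ltr0n -[ltRHS](@natN_h R n n_gt0) ltr_pM2r // ltr_nat.
by move=> /H h1 /H h2; move: hij; rewrite h1 h2.
Qed.

End Hats.

(** * Integration over a tiling *)

Section NullSets.
Local Open Scope ereal_scope.
Import HBNNSimple.
Context d (T : measurableType d) (R : realType).
Variable mu : {measure set T -> \bar R}.

(** The integral of a nonnegative function is a supremum over simple functions
below it, and cutting each of these off on N does not change its integral.  The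
function itself need not be measurable. *)
Lemma ge0_integral_off_null (D N : set T) (f : T -> \bar R) :
  measurable D -> measurable N -> mu N = 0 -> (forall x, D x -> 0 <= f x) ->
  \int[mu]_(x in D) f x = \int[mu]_(x in D `\` N) f x.
Proof.
move=> mD mN N0 f0; rewrite !ge0_integralE//; last by move=> x [/f0].
apply/eqP; rewrite eq_le; apply/andP; split.
- apply: ge_ereal_sup => _ [g /= gf <-].
  pose g' := proj_nnsfun g (measurableC mN).
  have g'E : g' =1 g \_ (~` N) by move=> x; rewrite /g' -mrestrict.
  apply: ereal_sup_ubound; exists g'.
    move=> x; rewrite g'E; have := gf x; rewrite !patchE in_setD in_setC.
    by case: (x \in D); case: (x \in N).
  rewrite -!integralT_nnsfun [RHS](ge0_negligible_integral mN) //; last 2 first.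
  - exact/measurable_EFinP.
  - by move=> x _; rewrite lee_fin.
  rewrite setTD [RHS]integral_mkcond.
  by apply: eq_integral => x _; rewrite g'E !patchE; case: ifP.
- apply: ge_ereal_sup => _ [g /= gf <-].
  apply: ereal_sup_ubound => /=; exists g => // x.
  apply: (le_trans (gf x)); rewrite !patchE in_setD.
  case: ifP => [/andP[-> _]//|_]; case: ifP => // /set_mem/f0//.
Qed.

Lemma integral_off_null (D N : set T) (f : T -> \bar R) :
  measurable D -> measurable N -> mu N = 0 ->
  \int[mu]_(x in D) f x = \int[mu]_(x in D `\` N) f x.
Proof.
move=> mD mN N0; rewrite integralE [RHS]integralE.
by congr (_ - _); apply: ge0_integral_off_null.
Qed.

End NullSets.

(** Disjoint tiles of total measure that of D fill D up to a null set; comparing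
measures avoids describing the part left over.  No measurability of f outside
the tiles is assumed: the partial derivatives of finite element functions are
not controlled on the edges. *)
Lemma Rintegral_tiling d (T : measurableType d) (R : realType)
    (mu : {measure set T -> \bar R}) (I : choiceType) (r : seq I) (P : I -> set T)
    (D : set T) (m : R) (c : I -> R) (f : T -> R) :
  measurable D -> (forall i, measurable (P i)) -> uniq r ->
  trivIset [set` r] P -> (forall i, i \in r -> P i `<=` D) ->
  (forall i, i \in r -> mu (P i) = m%:E) -> mu D = ((size r)%:R * m)%:E ->
  (forall i p, i \in r -> P i p -> f p = c i) ->
  \int[mu]_(p in D) f p = \sum_(i <- r) m * c i.
Proof.
move=> mD mP ur tP PD Pm Dm fc.
pose U := \big[setU/set0]_(i <- r) P i.
have mU : measurable U by apply: bigsetU_measurable.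
have UD : U `<=` D.
  by rewrite /U -bigcup_seq => x [i ir Pix]; exact: (PD i).
have mUf : measurable_fun U f.
  have : {subset r <= r} by [].
  rewrite /U; elim: {1 3}r => [|i s IH] sr.
    by rewrite big_nil; exact: measurable_fun_set0.
  rewrite big_cons; apply/measurable_funU => //; first exact: bigsetU_measurable.
  split; last by apply: IH => k ks; apply: sr; rewrite inE ks orbT.
  apply: (eq_measurable_fun (cst (c i))); last exact: measurable_cst.
  by move=> x /set_mem Pix; rewrite (fc i) // sr // mem_head.
have sumE (a : R) : \sum_(i <- r) a = (size r)%:R * a.
  by rewrite big_const_seq count_predT iter_addr_0 mulr_natl.
have muU : mu U = ((size r)%:R * m)%:E.
  rewrite -[LHS]mul1e -integral_cst // /U.
  rewrite (@integral_bigsetU_EFin _ _ _ _ _ _ (cst 1)) //; last first.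
    exact/measurable_EFinP/measurable_cst.
  rewrite -sumE -sumEFin big_seq [RHS]big_seq; apply: eq_bigr => i ir.
  by rewrite [LHS](integral_cst _ _ 1%E) // mul1e Pm.
have N0 : mu (D `\` U) = 0%E.
  have Dfin : (mu D < +oo)%E by rewrite Dm ltry.
  by rewrite measureD // (setIidr UD) [X in (_ - X)%E]muU [X in (X - _)%E]Dm subee.
rewrite /Rintegral (integral_off_null _ mD (measurableD mD mU) N0) setDD setIidr //.
rewrite integral_bigsetU_EFin //; last exact/measurable_EFinP.
rewrite big_seq (eq_bigr (fun i => (m * c i)%:E)) => [|i ir]; last first.
  rewrite (eq_integral (cst (c i)%:E)) => [|x /set_mem Pix]; last by rewrite (fc i).
  by rewrite integral_cst // Pm // -EFinM mulrC.
by rewrite -big_seq sumEFin.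
Qed.

(** * Integrals of affine functions and areas of triangles *)

Section Quadrature.
Variable R : realType.
Implicit Types a b p q r s : R.

Lemma integral_affine_product a b p q r s : a < b ->
  (\int[lebesgue_measure]_(t in `[a, b])
    ((p * (t - a) + q) * (r * (t - a) + s))%:E =
  (p * r / 3%:R * (b - a) ^+ 3 + (p * s + q * r) / 2%:R * (b - a) ^+ 2
   + q * s * (b - a))%:E)%E.
Proof.
move=> ab.
pose f t := (p * (t - a) + q) * (r * (t - a) + s).
pose F t := p * r / 3%:R * ((t - a) * ((t - a) * (t - a)))
  + (p * s + q * r) / 2%:R * ((t - a) * (t - a)) + q * s * (t - a).
have dF (t : R) : is_derive t 1 F (f t).
  by apply: is_derive_eq; rewrite /GRing.scale /= /f; field.
have cF : continuous F.
  by move=> t; apply/differentiable_continuous/derivable1_diffP; case: (dF t).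
rewrite (@continuous_FTC2 _ f F) //.
- rewrite -EFinB; congr (_%:E); rewrite /F; ring.
- apply: continuous_subspaceT => t.
  by apply: cvgM; apply: cvgD; try exact: cvg_cst; apply: cvgM;
    try exact: cvg_cst; apply: cvgB; try exact: cvg_cst; exact: cvg_id.
- split=> [t _| |].
  + by case: (dF t).
  + by apply: cvg_at_right_filter; exact: cF.
  + by apply: cvg_at_left_filter; exact: cF.
- by move=> t _; rewrite derive1E; case: (dF t).
Qed.

End Quadrature.

Section Triangles.
Variables (R : realType) (n : nat).
Hypothesis n_gt0 : (0 < n)%N.
Local Notation N := (2 * n)%N.
Local Notation d := (h R n).
Let d_gt0 : 0 < d := h_gt0 R n_gt0.

Lemma measurable_pos (g : R * R -> R) : measurable_fun setT g ->
  measurable [set p | 0 < g p].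
Proof.
move=> mg; rewrite (_ : [set _ | _] = setT `&` g @^-1` `]0, +oo[).
  by apply: mg.
by apply/seteqP; split => x /=; rewrite in_itv /= andbT // => -[].
Qed.

Lemma open_lower_measurable i j : measurable (@open_lower R n i j).
Proof.
rewrite (_ : open_lower n i j = [set p | 0 < p.2 - j%:R * d] `&`
  ([set p | 0 < (p.1 - i%:R * d) - (p.2 - j%:R * d)] `&`
  [set p | 0 < i.+1%:R * d - p.1])).
  apply: measurableI; last apply: measurableI; apply: measurable_pos.
  - by apply: measurable_funB.
  - by apply: measurable_funB; apply: measurable_funB.
  - by apply: measurable_funB.
by apply/seteqP; split => p /=; rewrite !subr_gt0 => -[] // ? [].
Qed.

Lemma open_upper_measurable i j : measurable (@open_upper R n i j).
Proof.
rewrite (_ : open_upper n i j = [set p | 0 < p.1 - i%:R * d] `&`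
  ([set p | 0 < (p.2 - j%:R * d) - (p.1 - i%:R * d)] `&`
  [set p | 0 < j.+1%:R * d - p.2])).
  apply: measurableI; last apply: measurableI; apply: measurable_pos.
  - by apply: measurable_funB.
  - by apply: measurable_funB; apply: measurable_funB.
  - by apply: measurable_funB.
by apply/seteqP; split => p /=; rewrite !subr_gt0 => -[] // ? [].
Qed.

(** By Fubini: the vertical sections are intervals of length x - i h. *)
Lemma mu2_open_lower i j : mu2 (open_lower n i j : set (R * R)) = (d ^+ 2 / 2%:R)%:E.
Proof.
rewrite /mu2 /product_measure1.
transitivity (\int[lebesgue_measure]_(x in `](i%:R * d)%R, (i.+1%:R * d)%R[)
    ((1 * (x - i%:R * d) + 0) * (0 * (x - i%:R * d) + 1))%:E)%E.
  rewrite [RHS]integral_mkcond; apply: eq_integral => x _ /=.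
  rewrite patchE; case: ifPn => hx.
    have {hx} : i%:R * d < x < i.+1%:R * d by move/set_mem: hx; rewrite /= in_itv.
    move=> /andP[x1 x2].
    rewrite (_ : xsection _ _ = `]j%:R * d, (j%:R * d + (x - i%:R * d))[%classic).
      rewrite lebesgue_measure_itv /= lte_fin ltrDl subr_gt0 x1 -EFinB.
      by congr (_%:E); ring.
    apply/seteqP; split => y; rewrite /xsection /= inE in_itv /=.
      by case=> /= *; apply/andP; split; lra.
    by move=> /andP[*]; split => /=; lra.
  rewrite (_ : xsection _ _ = set0) ?measure0 //.
  apply/seteqP; split => y //; rewrite /xsection /= inE => -[/= h1 h2 h3].
  by move/negP: hx; apply; apply/mem_set; rewrite /= in_itv /=; apply/andP; split; lra.
rewrite -(@integral_itv_bndoo _ _ _ _ true false).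
  rewrite integral_affine_product ?h_succ ?ltrDl //.
  by congr (_%:E); field.
by apply/measurable_EFinP; apply: measurable_funM; apply: measurable_funD => //;
  apply: measurable_funM => //; apply: measurable_funB.
Qed.

Lemma mu2_open_upper i j : mu2 (open_upper n i j : set (R * R)) = (d ^+ 2 / 2%:R)%:E.
Proof.
rewrite /mu2 /product_measure1.
transitivity (\int[lebesgue_measure]_(x in `](i%:R * d)%R, (i.+1%:R * d)%R[)
    (((-1) * (x - i%:R * d) + d) * (0 * (x - i%:R * d) + 1))%:E)%E.
  rewrite [RHS]integral_mkcond; apply: eq_integral => x _ /=.
  rewrite patchE; case: ifPn => hx.
    have {hx} : i%:R * d < x < i.+1%:R * d by move/set_mem: hx; rewrite /= in_itv.
    rewrite h_succ => /andP[x1 x2].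
    rewrite (_ : xsection _ _ = `](j%:R * d + (x - i%:R * d)), (j.+1%:R * d)[%classic).
      rewrite lebesgue_measure_itv /= lte_fin h_succ.
      rewrite ifT; last by lra.
      by rewrite -EFinB; congr (_%:E); ring.
    apply/seteqP; split => y; rewrite /xsection /= inE in_itv /=.
      by case=> /= *; apply/andP; split; lra.
    by move=> /andP[*]; split => /=; lra.
  rewrite (_ : xsection _ _ = set0) ?measure0 //.
  apply/seteqP; split => y //; rewrite /xsection /= inE => -[/= h1 h2].
  rewrite h_succ => h3.
  by move/negP: hx; apply; apply/mem_set; rewrite /= in_itv /= h_succ; apply/andP; split; lra.
rewrite -(@integral_itv_bndoo _ _ _ _ true false).
  rewrite integral_affine_product ?h_succ ?ltrDl //.
  by congr (_%:E); field.
by apply/measurable_EFinP; apply: measurable_funM; apply: measurable_funD => //;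
  apply: measurable_funM => //; apply: measurable_funB.
Qed.

End Triangles.

(** * The bilinear forms in nodal values *)

Section Forms.
Variables (R : realType) (n : nat).
Hypothesis n_gt0 : (0 < n)%N.
Local Notation N := (2 * n)%N.
Local Notation d := (h R n).
Let d_gt0 : 0 < d := h_gt0 R n_gt0.

Lemma half_h : n%:R * d = 1 / 2%:R.
Proof.
have := @natN_h R n n_gt0; rewrite natrM => E.
by lra.
Qed.

Definition strip (k m : nat) : set (R * R) :=
  [set p | k%:R * d < p.1 < (k + m)%:R * d /\ 0 < p.2 < 1].

Lemma Omega_strip : @Omega R = strip 0 N.
Proof. by rewrite /Omega /strip add0n natN_h // mul0r. Qed.

Lemma Omega1_strip : @Omega1 R = strip 0 n.
Proof. by rewrite /Omega1 /strip add0n half_h mul0r. Qed.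

Lemma Omega2_strip : @Omega2 R = strip n n.
Proof.
rewrite /Omega2 /strip half_h natrD mulrDl half_h.
by rewrite (_ : 1 / 2%:R + 1 / 2%:R = 1 :> R) //; field.
Qed.

Definition tile (t : nat * nat * bool) : set (R * R) :=
  if t.2 then open_lower n t.1.1 t.1.2 else open_upper n t.1.1 t.1.2.

Definition tiles k m : seq (nat * nat * bool) :=
  [seq (q, b) | q <- [seq (i, j) | i <- iota k m, j <- iota 0 N],
                b <- [:: true; false]].

Lemma tile_box i j b p : tile (i, j, b) p ->
  i%:R * d < p.1 < i.+1%:R * d /\ j%:R * d < p.2 < j.+1%:R * d.
Proof.
by case: b => -[]; rewrite /tile /= !h_succ => h1 h2 h3; split; apply/andP; split; lra.
Qed.

Lemma box_inj i i' (x : R) : i%:R * d < x < i.+1%:R * d ->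
  i'%:R * d < x < i'.+1%:R * d -> i = i'.
Proof.
move=> /andP[a b] /andP[a' b'].
have := lt_trans a b'; have := lt_trans a' b.
rewrite !ltr_pM2r // !ltr_nat !ltnS => h1 h2.
by apply/eqP; rewrite eqn_leq h1 h2.
Qed.

Lemma tile_inj s t p : tile s p -> tile t p -> s = t.
Proof.
case: s => -[i j] b; case: t => -[i' j'] b' hs ht.
have [hx hy] := tile_box hs; have [hx' hy'] := tile_box ht.
have ii := box_inj hx hx'; have jj := box_inj hy hy'; subst i' j'.
congr (_, _); move: hs ht {hx hy hx' hy'}.
by case: b; case: b' => // -[h1 h2 h3] -[h4 h5 h6]; exfalso; lra.
Qed.

Lemma tiles_uniq k m : uniq (tiles k m).
Proof.
apply: allpairs_uniq => //; last by move=> [a b] [a' b'] _ _ [-> ->].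
by apply: allpairs_uniq; rewrite ?iota_uniq // => -[a b] [a' b'] _ _ [-> ->].
Qed.

Lemma tilesP k m i j b : (i, j, b) \in tiles k m -> (k <= i < k + m)%N && (j < N)%N.
Proof.
move=> /allpairsP[[q c] /= [/allpairsP[[i' j'] /=]]].
rewrite !mem_iota add0n /= => -[hi hj ->] _ [-> -> _].
by rewrite hi hj.
Qed.

Lemma tile_strip k m t : t \in tiles k m -> tile t `<=` strip k m.
Proof.
case: t => -[i j] b /tilesP/andP[/andP[ki ikn] jN] p /tile_box[/andP[a1 a2] /andP[b1 b2]].
split; apply/andP; split.
- by apply: le_lt_trans a1; rewrite ler_pM2r // ler_nat.
- by apply: (lt_le_trans a2); rewrite ler_pM2r // ler_nat.
- by apply: le_lt_trans b1; rewrite mulr_ge0 // ltW.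
- by apply: (lt_le_trans b2); rewrite -[leRHS](@natN_h R n n_gt0) ler_pM2r // ler_nat.
Qed.

Lemma stripE k m : strip k m =
  (`](k%:R * d), ((k + m)%:R * d)[ `*` `]0, 1[)%classic.
Proof. by apply/seteqP; split => p; rewrite /strip /= !in_itv. Qed.

Lemma strip_measurable k m : measurable (strip k m).
Proof. by rewrite stripE; apply: measurableX. Qed.

Lemma mu2_strip k m : (0 < m)%N -> mu2 (strip k m) = (m%:R * d)%:E.
Proof.
move=> m_gt0.
have E1 : lebesgue_measure `](k%:R * d), ((k + m)%:R * d)[%classic = (m%:R * d)%:E.
  rewrite lebesgue_measure_itv /= lte_fin ltr_pM2r // ltr_nat.
  rewrite -[X in (X < _)%N]addn0 ltn_add2l m_gt0 -EFinB natrD.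
  by congr (_%:E); ring.
have E2 : lebesgue_measure (`]0, 1[%classic : set R) = 1%:E.
  by rewrite lebesgue_measure_itv /= lte_fin ltr01 -EFinB subr0.
rewrite stripE /mu2 product_measure1E // [X in (X * _)%E]E1 [X in (_ * X)%E]E2.
by rewrite -EFinM mulr1.
Qed.

Lemma area_tiles k m : m%:R * d = (size (tiles k m))%:R * (d ^+ 2 / 2%:R).
Proof.
rewrite /tiles !size_allpairs !size_iota /= -[LHS]mulr1 -[X in _ * X = _](@natN_h R n n_gt0).
by rewrite !natrM; field.
Qed.

(** Every square contributes two tiles of constant gradient; cutting the functions
off outside C does not affect their derivatives in an open triangle. *)
Lemma dirichlet_strip k m (C : set (R * R)) u v : (0 < m)%N -> (k + m <= N)%N ->
  strip k m `<=` C -> Vh n u -> Vh n v ->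
  dirichlet (strip k m) (u \_ C) (v \_ C) =
  energy m N (fun i j => node n u (k + i) j) (fun i j => node n v (k + i) j).
Proof.
move=> m_gt0 kN DC hu hv.
pose c (t : nat * nat * bool) : R :=
  let: (i, j, b) := t in
  if b then (node n u i.+1 j - node n u i j) / d * ((node n v i.+1 j - node n v i j) / d)
   + (node n u i.+1 j.+1 - node n u i.+1 j) / d
     * ((node n v i.+1 j.+1 - node n v i.+1 j) / d)
  else (node n u i.+1 j.+1 - node n u i j.+1) / d
     * ((node n v i.+1 j.+1 - node n v i j.+1) / d)
   + (node n u i j.+1 - node n u i j) / d * ((node n v i j.+1 - node n v i j) / d).
rewrite /dirichlet (@Rintegral_tiling _ _ R
   (@lebesgue_measure R \x @lebesgue_measure R)%E _ (tiles k m) tile _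
   (d ^+ 2 / 2%:R) c).
- rewrite /tiles !big_allpairs /energy.
  rewrite -{1}[k]addn0 iotaDl big_map /index_iota subn0; apply: eq_bigr => i _.
  rewrite subn0; apply: eq_bigr => j _.
  rewrite !big_cons big_nil /= addr0 /cell !addnS.
  by field; rewrite gt_eqF.
- exact: strip_measurable.
- by move=> [[i j] []]; [exact: open_lower_measurable | exact: open_upper_measurable].
- exact: tiles_uniq.
- by move=> s t _ _ [p [hs ht]]; exact: tile_inj hs ht.
- exact: tile_strip.
- by move=> [[i j] []] _; [exact: mu2_open_lower | exact: mu2_open_upper].
- by rewrite -area_tiles; exact: mu2_strip.
move=> [[i j] b] p ht hp; have /andP[/andP[ki ikn] jN] := tilesP ht.
have sub : tile (i, j, b) `<=` C by exact: subset_trans (tile_strip ht) DC.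
have iN : (i < N)%N by exact: leq_trans kN.
case: b hp sub {ht} => hp sub.
- have [-> ->] := grad_open_lower n_gt0 hu iN jN sub hp.
  by have [-> ->] := grad_open_lower n_gt0 hv iN jN sub hp.
- have [-> ->] := grad_open_upper n_gt0 hu iN jN sub hp.
  by have [-> ->] := grad_open_upper n_gt0 hv iN jN sub hp.
Qed.

(** Functions of V1 and V2 are cut off outside the closed halves, so this inclusion
is what preserves their values on the interface. *)
Lemma Gamma_closure k : (k == 0)%N || (k == n) -> @Gamma R `<=` closure (strip k n).
Proof.
move=> hk [x t] [/= -> t01] B /nbhs_ballP[e /= e0 eB].
pose dl := Num.min (e / 2%:R) (1 / 4%:R).
have dl0 : 0 < dl by rewrite lt_min divr_gt0 // divr_gt0.
have dl4 : dl <= 1 / 4%:R by rewrite ge_min lexx orbT.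
have dle : dl < e by rewrite gt_min; apply/orP; left; lra.
have near (y : R) : `|1 / 2%:R - y| < e -> ball (1 / 2%:R : R, t) e (y, t).
  by move=> hy; split; [exact: hy | exact: ballxx].
case/orP: hk => /eqP ->.
- exists (1 / 2%:R - dl, t); split.
    by rewrite -Omega1_strip; split => //=; apply/andP; split; lra.
  by apply/eB/near; rewrite opprB addrC subrK gtr0_norm.
- exists (1 / 2%:R + dl, t); split.
    by rewrite -Omega2_strip; split => //=; apply/andP; split; lra.
  by apply/eB/near; rewrite opprD addrA subrr sub0r normrN gtr0_norm.
Qed.

(** The interface is made of right edges of lower triangles of the left half. *)
Lemma trace_affine v j t : Vh n v -> (j < N)%N ->
  j%:R * d <= t <= j.+1%:R * d -> v (1 / 2%:R, t) =
  (node n v n j.+1 - node n v n j) / d * (t - j%:R * d) + node n v n j.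
Proof.
move=> hv jN; rewrite h_succ => /andP[t1 t2].
have nN : (n.-1 < N)%N by rewrite prednK // leq_pmull.
have nE : n%:R * d = n.-1%:R * d + d by rewrite -h_succ prednK.
have hp : lower_triangle n n.-1 j (1 / 2%:R, t).
  rewrite /lower_triangle /square /= !h_succ -half_h nE.
  by split; [split; apply/andP; split|]; lra.
rewrite (lower_affine n_gt0 hv nN jN hp) /= prednK // -half_h nE.
by field; rewrite gt_eqF.
Qed.

Lemma trace_continuous v : Vh n v -> continuous (fun t : R => v (1 / 2%:R, t)).
Proof.
move=> [cv _ _] t; apply: (@cvg_comp _ _ _ (fun t : R => (1 / 2%:R : R, t)) v _
  (nbhs ((1 / 2%:R, t) : R * R))); last exact: cv.
exact: (cvg_pair (cvg_cst _) (@cvg_id _ (nbhs t))).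
Qed.

(** Traces are affine on each mesh interval, where the integral of their product is
that of a quadratic polynomial. *)
Lemma pairing_mass u v U V : Vh n U -> Vh n V ->
  (forall p, Gamma p -> u p = U p) -> (forall p, Gamma p -> v p = V p) ->
  pairing u v = mass d N (node n U n) (node n V n).
Proof.
move=> hU hV uU vV.
pose f (t : R) := U (1 / 2%:R, t) * V (1 / 2%:R, t).
have cf : continuous f.
  by move=> t; apply: cvgM; exact: trace_continuous.
have itf (a b : R) : lebesgue_measure.-integrable `[a, b] (EFin \o f).
  apply: continuous_compact_integrable; first exact: segment_compact.
  exact: continuous_subspaceT.
have pieces k : (k <= N)%N -> \int[lebesgue_measure]_(t in `[0, (k%:R * d)]) f t =
   \sum_(0 <= j < k) d / 6%:R * mass_elt (node n U n) (node n V n) j.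
  elim: k => [|k IH] kN.
    by rewrite mul0r set_itv1 Rintegral_set1 big_geq.
  have kd : k%:R * d <= k.+1%:R * d by rewrite h_succ lerDl ltW.
  have k0 : 0 <= k%:R * d by rewrite mulr_ge0 // ltW.
  have {}IH := IH (ltnW kN).
  rewrite (big_nat_recr _ _ _ (leq0n k)) /= -{}IH.
  apply/eqP; rewrite addrC -subr_eq; apply/eqP.
  rewrite Rintegral_itvB; [|exact: itf|by rewrite bnd_simp|by rewrite bnd_simp].
  rewrite Rintegral_itv_obnd_cbnd; last first.
    apply: integrableS (itf (k%:R * d) (k.+1%:R * d)) => //.
    by apply: subset_itvr; rewrite bnd_simp.
  transitivity (\int[lebesgue_measure]_(t in `[(k%:R * d), (k.+1%:R * d)])
     (((node n U n k.+1 - node n U n k) / d * (t - k%:R * d) + node n U n k) *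
      ((node n V n k.+1 - node n V n k) / d * (t - k%:R * d) + node n V n k))).
    apply: eq_Rintegral => t /set_mem; rewrite /= in_itv /= => ht.
    by rewrite /f !(@trace_affine _ k).
  rewrite /Rintegral integral_affine_product; last by rewrite h_succ ltrDl.
  by rewrite /= h_succ /mass_elt; field; rewrite gt_eqF.
rewrite /mass -pieces // natN_h // /pairing.
transitivity (\int[lebesgue_measure]_(t in `]0, 1[) f t).
  apply: eq_Rintegral => t /set_mem; rewrite /= in_itv /= => ht.
  by rewrite /f uU // vV.
rewrite /Rintegral (@integral_itv_bndoo _ _ _ _ true false) //.
by apply/measurable_EFinP/measurable_funTS; apply: continuous_measurable_fun.
Qed.

End Forms.

(** * Compatibility of the two half problems *)

Section GridChanges.
Variable R : realType.
Implicit Types (x y : nat -> nat -> R).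

Lemma eq_energy m N x x' y y' :
  (forall i j, (i <= m)%N -> (j <= N)%N -> x i j = x' i j) ->
  (forall i j, (i <= m)%N -> (j <= N)%N -> y i j = y' i j) ->
  energy m N x y = energy m N x' y'.
Proof.
move=> xx yy; apply: eq_big_nat => i /andP[_ im].
apply: eq_big_nat => j /andP[_ jN].
by rewrite /cell !xx ?yy // ltnW.
Qed.

Lemma energy_cat k m N x y : energy (k + m) N x y =
  energy k N x y + energy m N (fun i j => x (k + i)%N j) (fun i j => y (k + i)%N j).
Proof.
rewrite /energy (@big_cat_nat _ _ _ k) ?leq_addr //=; congr (_ + _).
rewrite -{1}[k]add0n big_addn addKn; apply: eq_bigr => i _.
by apply: eq_bigr => j _; rewrite /cell !addnS [(i + k)%N]addnC.
Qed.

(** The element energies are invariant under the exchange of the two vertical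
sides of a square, though the diagonal is not.  This is the symmetry that gives
both halves the same Dirichlet-to-Neumann operator. *)
Lemma energy_reflect m N x y : energy m N x y =
  energy m N (fun i j => x (m - i)%N j) (fun i j => y (m - i)%N j).
Proof.
rewrite /energy big_nat_rev /=; apply: eq_big_nat => i /andP[_ im].
apply: eq_bigr => j _; rewrite add0n /cell.
have -> : (m - i = (m - i.+1).+1)%N by rewrite subnSK.
by congr (_ / _); ring.
Qed.

End GridChanges.

Section Consistency.
Variables (R : realType) (n : nat).
Hypothesis n_gt0 : (0 < n)%N.
Local Notation N := (2 * n)%N.
Local Notation d := (h R n).
Local Notation mu := (@lebesgue_measure R \x @lebesgue_measure R)%E.
Local Notation plane := (measurableTypeR R * measurableTypeR R)%type.
Implicit Types (f g u v : R * R -> R).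

Lemma test_function (c : nat -> nat -> R) :
  (forall i j, (i <= N)%N -> (j <= N)%N ->
    ~~ ((0 < i < N) && (0 < j < N))%N -> c i j = 0) ->
  exists2 v, tame n v & forall i j, (i <= N)%N -> (j <= N)%N -> node n v i j = c i j.
Proof.
move=> hc; have [v tv vE] := interpolation n_gt0 c.
exists v => // i j iN jN; rewrite /node vE.
by case: ifPn => // hij; rewrite hc.
Qed.

(** |f v| <= M (1 + f^2) where |v| <= M, and the square has finite measure. *)
Lemma integrable_test f v : L2Omega f -> tame n v ->
  mu.-integrable (@Omega R)
    (EFin \o (fun p => f p * v p)).
Proof.
move=> hf [_ mv [M vM]].
have mO : measurable (@Omega R : set plane).
  by rewrite (Omega_strip R n_gt0); exact: strip_measurable.
have muO : (mu (@Omega R) < +oo)%E.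
  by rewrite (Omega_strip R n_gt0) [X in (X < _)%E](mu2_strip R n_gt0) ?ltry //
    muln_gt0.
pose F : R * R -> R := f \_ (@Omega R).
have mF : measurable_fun setT F.
  by have := sub_Lfun_mfun hf; rewrite inE.
have iF : mu.-integrable setT (fun p => (F p ^+ 2)%:E) by exact: Lfun2_integrable_sqr.
have i1 : mu.-integrable (@Omega R) (EFin \o cst (1 : R)).
  apply/integrableP; split; first exact/measurable_EFinP.
  rewrite (eq_integral (cst 1%E)) => [|p _]; last by rewrite /= normr1.
  by rewrite integral_cst // mul1e.
have M0 : 0 <= M by apply: le_trans (vM (0, 0)).
have ig : mu.-integrable (@Omega R) (EFin \o (fun p => M * (1 + F p ^+ 2))).
  rewrite (_ : EFin \o _ =
      (fun p => M%:E * ((EFin \o cst (1%R : R)) p + (F p ^+ 2)%R%:E)%E)%E).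
    apply: integrableZl => //; apply: integrableD => //.
    exact: integrableS iF.
  by apply/funext => p; rewrite /= EFinM EFinD.
apply: (le_integrable mO _ _ ig).
  apply/measurable_EFinP; apply: (eq_measurable_fun (fun p => F p * v p)).
    by move=> p pO; rewrite /F patchE pO.
  by apply: measurable_funTS; apply: measurable_funM.
move=> p Op; rewrite /= lee_fin normrM.
have -> : f p = F p by rewrite /F patchE mem_set.
rewrite [leRHS]ger0_norm; last by rewrite mulr_ge0 // addr_ge0 // sqr_ge0.
rewrite mulrC; apply: ler_pM => //.
rewrite -[F p ^+ 2]real_normK ?num_real //.
by have := sqr_ge0 (`|F p| - 1); have := normr_ge0 (F p); nra.
Qed.

Lemma inner_split f v : L2Omega f -> tame n v ->
  inner (@Omega R) f v = inner (@Omega1 R) f v + inner (@Omega2 R) f v.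
Proof.
move=> hf tv; have itf := integrable_test hf tv.
have mO : measurable (@Omega R : set plane).
  by rewrite (Omega_strip R n_gt0); exact: strip_measurable.
have m1 : measurable (@Omega1 R : set plane).
  by rewrite (Omega1_strip R n_gt0); exact: strip_measurable.
have m2 : measurable (@Omega2 R : set plane).
  by rewrite (Omega2_strip R n_gt0); exact: strip_measurable.
have sub : (@Omega1 R `|` @Omega2 R) `<=` @Omega R.
  by move=> p [] [/andP[a b] e]; split=> //; apply/andP; split; lra.
have disj : [disjoint @Omega1 R & @Omega2 R].
  by apply/disj_setPS => p [[/andP[a b] _] [/andP[a' b'] _]]; lra.
have muO : mu2 (@Omega R) = 1%:E.
  by rewrite (Omega_strip R n_gt0) mu2_strip ?muln_gt0 // natN_h.
have muU : mu2 (@Omega1 R `|` @Omega2 R) = 1%:E.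
  rewrite /mu2 measureU //; last exact/disj_set2P.
  rewrite (Omega1_strip R n_gt0) (Omega2_strip R n_gt0).
  rewrite [X in (X + _)%E](mu2_strip R n_gt0) //.
  rewrite [X in (_ + X)%E](mu2_strip R n_gt0) //.
  by rewrite -EFinD half_h //; congr (_%:E); field.
have N0 : mu2 (@Omega R `\` (@Omega1 R `|` @Omega2 R)) = 0%E.
  rewrite /mu2 measureD //; last 2 first.
  - exact: measurableU.
  - by rewrite [X in (X < _)%E]muO ltry.
  by rewrite (setIidr sub) [X in (_ - X)%E]muU [X in (X - _)%E]muO subee.
rewrite /inner -Rintegral_setU //; last first.
  by apply: integrableS itf => //; exact: measurableU.
rewrite /Rintegral; congr fine.
rewrite (integral_off_null _ mO _ N0); last by apply: measurableD => //; exact: measurableU.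
by rewrite setDD setIidr.
Qed.

Lemma inner_patch f v (D C : set (R * R)) : D `<=` C ->
  inner D f (v \_ C) = inner D f v.
Proof.
move=> DC; apply: eq_Rintegral => p /set_mem Dp.
by rewrite patchE mem_set //; exact: DC.
Qed.

(** The iterates on the interface are prescribed at its points only; they are
studied through a finite element function that agrees with them there. *)
Definition trace_of g G := Vh n G /\ forall p, @Gamma R p -> g p = G p.

Lemma trace_lin s t g g' G G' (k : R * R -> R) :
  (forall p, @Gamma R p -> k p = s * g p + t * g' p) ->
  trace_of g G -> trace_of g' G' -> trace_of k (fun p => s * G p + t * G' p).
Proof.
move=> kE [hG gG] [hG' gG']; split; first exact: Vh_lin.
by move=> p hp; rewrite kE // gG // gG'.
Qed.

Lemma VGamma_trace g : VGamma n g -> exists G, trace_of g G.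
Proof.
by move=> [G hG <-]; exists G; split => // p hp; rewrite patchE mem_set.
Qed.

Lemma patch_trace k U : (k == 0)%N || (k == n) -> Vh n U ->
  trace_of (U \_ (closure (strip n k n))) U.
Proof.
move=> hk hU; split=> // p hp; rewrite patchE mem_set //.
exact: (Gamma_closure n_gt0 hk).
Qed.

Lemma robin_nodes k gam f g G U v : (k == 0)%N || (k == n) ->
  Vh n U -> trace_of g G -> Vh n v ->
  robin_identity (strip n k n)
    [set w \_ (closure (strip n k n)) | w in Vh n] gam f g
    (U \_ (closure (strip n k n))) ->
  energy n N (fun i j => node n U (k + i) j) (fun i j => node n v (k + i) j)
    + gam * mass d N (node n U n) (node n v n) =
  inner (strip n k n) f v + mass d N (node n G n) (node n v n).
Proof.
move=> hk hU [hG gG] hv id.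
have := id _ (ex_intro2 _ _ v hv erefl).
have sub : (strip n k n : set (R * R)) `<=` closure (strip n k n) by exact: subset_closure.
have kN : (k + n <= N)%N.
  by rewrite mul2n -addnn leq_add2r; case/orP: hk => /eqP ->.
have [_ vT] := patch_trace hk hv; have [_ UT] := patch_trace hk hU.
by rewrite dirichlet_strip // inner_patch // (pairing_mass n_gt0 hU hv UT vT)
  (pairing_mass n_gt0 hG hv gG vT).
Qed.

(** By [mass_ge] the mass dominates the sum of squares. *)
Lemma mass_definite (r : nat -> R) : vanishing N r -> mass d N r r = 0 ->
  forall j, (j <= N)%N -> r j = 0.
Proof.
move=> hr r0 j; rewrite leq_eqVlt => /predU1P[->|jN]; first exact: hr.2.
have d0 := h_gt0 R n_gt0.
have d3 : 0 < d / 3%:R by lra.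
have := mass_ge (ltW d0) hr; rewrite r0 pmulr_rle0 // => hs.
have : \sum_(0 <= i < N) r i ^+ 2 == 0.
  by rewrite eq_le hs sumr_ge0 // => i _; exact: sqr_ge0.
rewrite psumr_eq0 => [/allP/(_ j)|i _]; last exact: sqr_ge0.
by rewrite mem_index_iota jN sqrf_eq0 => /(_ isT)/eqP.
Qed.

Lemma node_vanishing v i : Vh n v -> vanishing N (node n v i).
Proof. by move=> hv; split; rewrite node_boundary // ltnn ?andbF. Qed.

(** Adding the two Robin identities and subtracting the equation for uh on the
whole square leaves the mass product of g1 + g2 - (gamma1 + gamma2) uh with every
trace.  Testing on the residual itself shows that it is zero. *)
Lemma consistency (gamma1 gamma2 : R) f uh g1 g2 G1 G2 : L2Omega f ->
  fem_solution n f uh -> exact_interface_data n gamma1 gamma2 f uh g1 g2 ->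
  trace_of g1 G1 -> trace_of g2 G2 ->
  forall j, node n G2 n j = - node n G1 n j + (gamma2 + gamma1) * node n uh n j.
Proof.
move=> hf [hu fem] [_ _ id1 id2] t1 t2 j; have [hG1 _] := t1; have [hG2 _] := t2.
case: (leqP j N) => jN; last first.
  by rewrite !node_boundary ?mulr0 ?oppr0 ?addr0 // (ltnNge j) (ltnW jN) !andbF.
pose r p := 1 * (1 * G1 p + 1 * G2 p) + - (gamma2 + gamma1) * uh p.
have hr : Vh n r by apply: Vh_lin => //; exact: Vh_lin.
have [|v tv vE] := @test_function (spike n (node n r n)).
  move=> i k iN kN hik; rewrite /spike; case: eqP => // ni; subst i.
  exact: node_boundary.
have [hv _ _] := tv.
have vr : forall k, (k <= N)%N -> node n v n k = node n r n k.
  by move=> k kN; rewrite vE ?spikeE // mul2n -addnn leq_addr.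
have R1 : energy n N (node n uh) (node n v)
    + gamma1 * mass d N (node n uh n) (node n v n) =
    inner (@Omega1 R) f v + mass d N (node n G1 n) (node n v n).
  move: id1; rewrite /V1 (Omega1_strip R n_gt0) => id1.
  exact: (@robin_nodes 0 gamma1 f g1 G1 uh v).
have R2 : energy n N (fun i j => node n uh (n + i) j) (fun i j => node n v (n + i) j)
    + gamma2 * mass d N (node n uh n) (node n v n) =
    inner (@Omega2 R) f v + mass d N (node n G2 n) (node n v n).
  move: id2; rewrite /V2 (Omega2_strip R n_gt0) => id2.
  by apply: (@robin_nodes n gamma2 f g2 G2 uh v) => //; rewrite eqxx orbT.
have := fem v hv; rewrite (inner_split hf tv).
have pT (w : R * R -> R) : w \_ setT = w by exact: patch_setT.
have N_gt0 : (0 < N)%N by rewrite muln_gt0.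
have := @dirichlet_strip R n n_gt0 0 N setT uh v N_gt0 (leqnn _) (@subsetT _ _) hu hv.
rewrite !pT -(Omega_strip R n_gt0) => ->.
have -> : energy N N (fun i j => node n uh (0 + i) j) (fun i j => node n v (0 + i) j)
    = energy (n + n) N (node n uh) (node n v) by rewrite addnn -mul2n.
rewrite energy_cat => R0.
have : mass d N (node n r n) (node n r n) = 0.
  rewrite -(@eq_mass _ _ _ _ (node n r n) _ _ (fun _ _ => erefl) vr).
  rewrite [node n r n](_ : _ = fun j =>
    1 * (fun j => 1 * node n G1 n j + 1 * node n G2 n j) j
    + - (gamma2 + gamma1) * node n uh n j) // !massDl.
  move: R0 R1 R2; rewrite /=; lra.
move=> /(mass_definite (node_vanishing n hr)) /(_ j jN).
by rewrite /node /r; lra.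
Qed.

End Consistency.

(** * Error propagation *)

Section Iteration.
Variables (R : realType) (n : nat).
Hypothesis n_gt0 : (0 < n)%N.
Local Notation N := (2 * n)%N.
Local Notation d := (h R n).
Implicit Types (f g u v : R * R -> R).

Definition left_half v : nat -> nat -> R := fun i j => node n v i j.

(** Both halves are numbered from the outer boundary to the interface, so that they
become the same grid. *)
Definition right_half v : nat -> nat -> R := fun i j => node n v (n + (n - i)) j.

Lemma left_half_admissible v : Vh n v -> admissible N (left_half v).
Proof.
move=> hv; split=> [j|i]; last exact: node_vanishing.
by rewrite /left_half node_boundary.
Qed.

Lemma right_half_admissible v : Vh n v -> admissible N (right_half v).
Proof.
move=> hv; split=> [j|i]; last exact: node_vanishing.
by rewrite /right_half node_boundary // subn0 addnn -mul2n ltnn andbF.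
Qed.

Lemma right_halfE v : right_half v n = node n v n.
Proof. by rewrite /right_half subnn addn0. Qed.

Lemma box_boundary i j : (i <= N)%N -> (j <= N)%N ->
  ~~ ((0 < i < N) && (0 < j < N))%N -> [\/ i = 0%N, i = N | j = 0%N \/ j = N].
Proof.
have H k : (k <= N)%N -> ~~ (0 < k < N)%N -> k = 0%N \/ k = N.
  case: (posnP k) => [->|_] /= kN; first by left.
  by rewrite -leqNgt => Nk; right; apply/eqP; rewrite eqn_leq kN Nk.
move=> iN jN; rewrite negb_and => /orP[/(H i iN)[hi|hi]|/(H j jN) hj];
  [exact: Or31 | exact: Or32 | exact: Or33].
Qed.

Lemma n_leN : (n <= N)%N. Proof. by rewrite leq_pmull. Qed.

Lemma left_half_extension y : admissible N y -> exists2 v, Vh n v &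
  forall i j, (i <= n)%N -> (j <= N)%N -> left_half v i j = y i j.
Proof.
move=> [y0 yb].
have [|v [hv _ _] vE] := @test_function R n n_gt0
    (fun i j => if (i <= n)%N then y i j else 0).
  move=> i j iN jN /(box_boundary iN jN)[->|->|].
  - by rewrite y0.
  - by rewrite mul2n -addnn -{3}[n]addn0 leq_add2l leqNgt n_gt0.
  - by have [b0 bN] := yb i; case=> ->; rewrite ?b0 ?bN if_same.
exists v => // i j iN jN; rewrite /left_half vE ?iN //.
exact: leq_trans n_leN.
Qed.

Lemma right_half_extension y : admissible N y -> exists2 v, Vh n v &
  forall i j, (i <= n)%N -> (j <= N)%N -> right_half v i j = y i j.
Proof.
move=> [y0 yb].
have [|v [hv _ _] vE] := @test_function R n n_gt0
    (fun i j => if (n <= i)%N then y (N - i)%N j else 0).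
  move=> i j iN jN /(box_boundary iN jN)[->|->|].
  - by rewrite leqNgt n_gt0.
  - by rewrite subnn y0 if_same.
  - by have [b0 bN] := yb (N - i)%N; case=> ->; rewrite ?b0 ?bN if_same.
exists v => // i j iN jN; rewrite /right_half vE ?leq_addr //.
  by rewrite mul2n -addnn subnDl subKn.
by rewrite mul2n -addnn leq_add2l leq_subr.
Qed.

(** The load f cancels between two Robin problems with the same parameter, which
makes the error equations homogeneous. *)
Lemma robin_difference k gam f g g' G G' U U' v : (k == 0)%N || (k == n) ->
  Vh n U -> Vh n U' -> trace_of n g G -> trace_of n g' G' -> Vh n v ->
  robin_identity (strip n k n)
    [set w \_ (closure (strip n k n)) | w in Vh n] gam f g
    (U \_ (closure (strip n k n))) ->
  robin_identity (strip n k n)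
    [set w \_ (closure (strip n k n)) | w in Vh n] gam f g'
    (U' \_ (closure (strip n k n))) ->
  let D := fun p => 1 * U p + -1 * U' p in
  let E := fun p => 1 * G p + -1 * G' p in
  energy n N (fun i j => node n D (k + i) j) (fun i j => node n v (k + i) j)
    + gam * mass d N (node n D n) (node n v n) = mass d N (node n E n) (node n v n).
Proof.
move=> hk hU hU' tG tG' hv id id' D E.
have := robin_nodes n_gt0 hk hU tG hv id.
have := robin_nodes n_gt0 hk hU' tG' hv id'.
have -> : (fun i j => node n D (k + i) j) = fun i j =>
  1 * (fun i j => node n U (k + i) j) i j + -1 * (fun i j => node n U' (k + i) j) i j by [].
have -> : node n D n = fun j => 1 * node n U n j + -1 * node n U' n j by [].
have -> : node n E n = fun j => 1 * node n G n j + -1 * node n G' n j by [].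
by rewrite energyDl !massDl /=; lra.
Qed.

Lemma left_error gam f g g' G G' U U' :
  Vh n U -> Vh n U' -> trace_of n g G -> trace_of n g' G' ->
  robin_identity (@Omega1 R) (V1 n) gam f g (U \_ (closure (@Omega1 R))) ->
  robin_identity (@Omega1 R) (V1 n) gam f g' (U' \_ (closure (@Omega1 R))) ->
  let D := fun p => 1 * U p + -1 * U' p in
  let E := fun p => 1 * G p + -1 * G' p in
  forall y, admissible N y ->
    energy n N (left_half D) y + gam * mass d N (left_half D n) (y n) =
    mass d N (node n E n) (y n).
Proof.
move=> hU hU' tG tG' id id' D E y hy.
move: id id'; rewrite /V1 (Omega1_strip R n_gt0) => id id'.
have [v hv vE] := left_half_extension hy.
have := @robin_difference 0 gam f g g' G G' U U' v isT hU hU' tG tG' hv id id'.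
rewrite -/D -/E /= => H.
rewrite -(@eq_energy _ n N (left_half D) _ (left_half v)) //.
have yn j : (j <= N)%N -> node n v n j = y n j by exact: vE.
by rewrite -!(@eq_mass _ _ _ _ _ _ _ (fun _ _ => erefl) yn).
Qed.

Lemma right_error gam f g g' G G' U U' :
  Vh n U -> Vh n U' -> trace_of n g G -> trace_of n g' G' ->
  robin_identity (@Omega2 R) (V2 n) gam f g (U \_ (closure (@Omega2 R))) ->
  robin_identity (@Omega2 R) (V2 n) gam f g' (U' \_ (closure (@Omega2 R))) ->
  let D := fun p => 1 * U p + -1 * U' p in
  let E := fun p => 1 * G p + -1 * G' p in
  forall y, admissible N y ->
    energy n N (right_half D) y + gam * mass d N (right_half D n) (y n) =
    mass d N (node n E n) (y n).
Proof.
move=> hU hU' tG tG' id id' D E y hy.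
move: id id'; rewrite /V2 (Omega2_strip R n_gt0) => id id'.
have [v hv vE] := right_half_extension hy.
have hk : (n == 0)%N || (n == n) by rewrite eqxx orbT.
have := @robin_difference n gam f g g' G G' U U' v hk hU hU' tG tG' hv id id'.
rewrite -/D -/E /= energy_reflect => H.
rewrite -(@eq_energy _ n N (right_half D) _ (right_half v)) //.
have yn j : (j <= N)%N -> node n v n j = y n j.
  by move=> jN; rewrite -vE // right_halfE.
by rewrite right_halfE -!(@eq_mass _ _ _ _ _ _ _ (fun _ _ => erefl) yn).
Qed.

(** One turn of the algorithm, expressed with finite element functions that
represent the iterates. *)
Lemma iteration_step gamma1 gamma2 theta f um wm g1m g2m g1tm m G :
  robin_robin n gamma1 gamma2 theta f um wm g1m g2m g1tm ->
  trace_of n (g1m m) G -> exists U W, let G2 := fun p => -1 * G p + (gamma2 + gamma1) * U p in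
  let Gt := fun p => -1 * G2 p + (gamma1 + gamma2) * W p in
  [/\ Vh n U /\ um m = U \_ (closure (@Omega1 R)),
      Vh n W /\ wm m = W \_ (closure (@Omega2 R)),
      trace_of n (g2m m) G2 &
      trace_of n (g1m m.+1) (fun p => theta * G p + (1 - theta) * Gt p)].
Proof.
move=> [_ hu hg2 hw hgt hg1] tG.
have [[U hU UE] _] := hu m; have [[W hW WE] _] := hw m.
have tU : trace_of n (um m) U.
  by rewrite -UE (Omega1_strip R n_gt0); exact: (@patch_trace _ _ n_gt0 0).
have tW : trace_of n (wm m) W.
  by rewrite -WE (Omega2_strip R n_gt0); apply: (@patch_trace _ _ n_gt0 n);
    rewrite ?eqxx ?orbT.
exists U, W => G2 Gt.
have t2 : trace_of n (g2m m) G2.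
  by apply: trace_lin tG tU => p hp; rewrite hg2 // mulN1r.
have tt : trace_of n (g1tm m) Gt.
  by apply: trace_lin t2 tW => p hp; rewrite hgt // mulN1r.
split; [by split; rewrite ?UE | by split; rewrite ?WE | exact: t2 |].
by apply: trace_lin tG tt => p hp; rewrite hg1.
Qed.

Lemma iterate_trace gamma1 gamma2 theta f um wm g1m g2m g1tm m :
  robin_robin n gamma1 gamma2 theta f um wm g1m g2m g1tm ->
  exists G, trace_of n (g1m m) G.
Proof.
move=> H; elim: m => [|m [G tG]]; first exact: VGamma_trace (rr_init H).
by have [U [W [_ _ _ t]]] := iteration_step H tG; eexists; exact: t.
Qed.

Lemma normGamma_mass g g' G G' : trace_of n g G -> trace_of n g' G' ->
  let e := fun j => 1 * node n G n j + -1 * node n G' n j in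
  normGamma (fun p => g p - g' p) = Num.sqrt (mass d N e e).
Proof.
move=> [hG gG] [hG' gG'] e.
have hE : Vh n (fun p => 1 * G p + -1 * G' p) by exact: Vh_lin.
have gE p : @Gamma R p -> g p - g' p = 1 * G p + -1 * G' p.
  by move=> hp; rewrite gG // gG' // mul1r mulN1r.
by rewrite /normGamma (pairing_mass n_gt0 hE hE gE gE).
Qed.

End Iteration.

Unset Implicit Arguments.

Theorem theorem3p1 (R : realType) (n : nat) (hn : (1 <= n)%N)
    (gamma1 gamma2 theta : R)
    (hgamma1 : gamma1 = 1) (hgamma2 : gamma2 = 64%:R * (h R n)^-1)
    (htheta : theta = 3%:R / 7%:R)
    (f : R * R -> R) (hf : L2Omega f)
    (uh : R * R -> R) (huh : fem_solution n f uh)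
    (g1 g2 : R * R -> R)
    (hg : exact_interface_data n gamma1 gamma2 f uh g1 g2)
    (um wm g1m g2m g1tm : nat -> R * R -> R)
    (hrr : robin_robin n gamma1 gamma2 theta f um wm g1m g2m g1tm) (m : nat) :
  normGamma (fun p => g1 p - g1m m.+1 p) <=
    1 / 7%:R * normGamma (fun p => g1 p - g1m m p).
Proof.
have [hu _] := huh.
have [hg1 hg2 id1 id2] := hg.
have [G1 t1] := VGamma_trace hg1; have [G2 t2] := VGamma_trace hg2.
have cons := consistency hn hf huh hg t1 t2.
have [G tG] := iterate_trace hn m hrr.
have [U [W [[hU UE] [hW WE] tG2 tG']]] := iteration_step hn hrr tG.
have [_ idu] := rr_u hrr m; have [_ idw] := rr_w hrr m.
rewrite UE in idu; rewrite WE in idw.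
have xE := left_error hn hu hU t1 tG id1 idu.
have wE := right_error hn hu hW t2 tG2 id2 idw.
have hD : Vh n (fun p => 1 * uh p + -1 * U p) by exact: Vh_lin.
have hD' : Vh n (fun p => 1 * uh p + -1 * W p) by exact: Vh_lin.
have hE : Vh n (fun p => 1 * G1 p + -1 * G p) by exact: Vh_lin t1.1 tG.1.
rewrite (normGamma_mass hn t1 tG') (normGamma_mass hn t1 tG).
set e' := fun j : nat => 1 * node n G1 n j + -1 * node n (fun p => theta * _ + _) n j.
set e := fun j : nat => 1 * node n G1 n j + -1 * node n G n j.
pose x := left_half n (fun p => 1 * uh p + -1 * U p).
pose w := right_half n (fun p => 1 * uh p + -1 * W p).
pose e2 j : R := 1 * node n G2 n j
  + -1 * (-1 * node n G n j + (gamma2 + gamma1) * node n U n j).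
pose et j : R := - e2 j + (1 + 64%:R / h R n) * w n j.
have xn j : x n j = 1 * node n uh n j + -1 * node n U n j by [].
have wn j : w n j = 1 * node n uh n j + -1 * node n W n j.
  by rewrite /w right_halfE.
have : 49%:R * mass (h R n) (2 * n) e' e' <= mass (h R n) (2 * n) e e.
  apply: (@grid_contraction R n hn x w e e2 et e').
  - exact: left_half_admissible.
  - exact: right_half_admissible.
  - exact: node_vanishing hE.
  - by move=> y /xE; rewrite hgamma1 mul1r.
  - by move=> j; rewrite /e2 /e xn cons hgamma1 hgamma2; ring.
  - by move=> y hy; rewrite -hgamma2; exact: wE.
  - by [].
  - move=> j; rewrite /et -hgamma2 /e' /e /e2 wn.
    rewrite [node n (fun p => theta * _ + _) n j](_ : _ =
      theta * node n G n j + (1 - theta) *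
      (-1 * (-1 * node n G n j + (gamma2 + gamma1) * node n U n j)
       + (gamma1 + gamma2) * node n W n j)) //.
    by rewrite cons htheta hgamma1; field.
move=> H.
rewrite (_ : 1 / 7%:R = Num.sqrt ((1 / 7%:R) ^+ 2)); last first.
  by rewrite sqrtr_sqr ger0_norm // divr_ge0.
rewrite -sqrtrM ?sqr_ge0 //; apply: ler_wsqrtr.
by move: H; set P := mass _ _ e' e'; set Q := mass _ _ e e; lra.
Qed.
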